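(* Let $C_4\subset\mathbb{P}^{14}$ be the projectivized tangent cone to a normal slice to the minimal orbit $\mathcal{O}'_3\simeq\mathbb{P}^3$ in the variety of reductions $Red(4)$. Then $C_4\subset\mathbb{P}^{14}$ is projectively equivalent to the Grassmannian $G(2,6)\subset\mathbb{P}^{14}$ in its Plücker embedding.
   Context: Everything is over $\mathbb{C}$. $Red(4)$ is the Zariski closure, in the Grassmannian $G(3,\mathfrak{sl}_4)$ of $3$-dimensional linear subspaces of $\mathfrak{sl}_4$, of the set of Cartan subalgebras of $\mathfrak{sl}_4$ (the subalgebras of traceless matrices diagonal with respect to some basis of $\mathbb{C}^4$), with its reduced structure. $\mathcal{O}'_3\subset Red(4)$ is the closed $PGL_4$-orbit of the subalgebras $\{x\in\mathfrak{gl}_4:\mathrm{Im}(x)\subset V\subset\mathrm{Ker}(x)\}$, where $V$ runs over the lines of $\mathbb{C}^4$ (the dual orbit $\mathcal{O}''_3\simeq\check{\mathbb{P}}^3$, with $V$ running over hyperplanes, is exchanged with it by transposition). At a point $p\in\mathcal{O}'_3$ the Zariski tangent space $T_pRed(4)$ has dimension $18$ and $T_p\mathcal{O}'_3$ has dimension $3$; $C_4$ is the projectivization, in $\mathbb{P}(T_pRed(4)/T_p\mathcal{O}'_3)\simeq\mathbb{P}^{14}$, of the tangent cone at $p$ to a slice of $Red(4)$ transverse to $\mathcal{O}'_3$ (equivalently, of the image of the tangent cone of $Red(4)$ at $p$, which is invariant under translation by $T_p\mathcal{O}'_3$). *)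

(* Defs.v *)
From HB Require Import structures.
From mathcomp Require Import all_boot all_order all_algebra.
From mathcomp Require Import reals complex.
From mathcomp Require Import mpoly.

Set Implicit Arguments.
Unset Strict Implicit.
Unset Printing Implicit Defensive.

Import GRing.Theory.
Local Open Scope ring_scope.

(* Affine schemes are represented by ideals in {mpoly K[n]} (as predicates) and
   points of affine n-space by row vectors. *)

Section Ideals.
Variables (K : fieldType) (n : nat).
Implicit Types (I J G : {mpoly K[n]} -> Prop) (Z : 'rV[K]_n -> Prop).

Definition ideal_gen G (f : {mpoly K[n]}) : Prop :=
  exists s : seq ({mpoly K[n]} * {mpoly K[n]}),
    (forall ag, ag \in s -> G ag.2) /\ f = \sum_(ag <- s) ag.1 * ag.2.

Definition vanishing_ideal Z (f : {mpoly K[n]}) : Prop :=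
  forall x, Z x -> f.@[x 0] = 0.

Definition initial_form (f g : {mpoly K[n]}) : Prop :=
  exists d : nat,
    (forall d' : nat, (d' < d)%N -> pihomog mdeg d' f = 0)
    /\ g = pihomog mdeg d f.

(* For an affine variety Z through the origin: the ideal of the (scheme
   theoretic) tangent cone, and the Zariski tangent space, both at the origin. *)
Definition tangent_cone_ideal Z : {mpoly K[n]} -> Prop :=
  ideal_gen (fun g => exists2 f, vanishing_ideal Z f & initial_form f g).

Definition tangent_space Z (x : 'rV[K]_n) : Prop :=
  forall f, vanishing_ideal Z f ->
    \sum_(i < n) (f^`M(i)).@[fun=> 0] * x 0 i = 0.

Definition saturation I (f : {mpoly K[n]}) : Prop :=
  exists d : nat, forall m : 'X_{1..n}, mdeg m = d -> I ('X_[m] * f).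

(* Homogeneous ideals define the same closed subscheme of the projective space
   P^(n-1) iff they have the same saturation by the irrelevant ideal. *)
Definition same_Proj I J : Prop :=
  forall f, saturation I f <-> saturation J f.

End Ideals.

Section LinearQuotient.
Variables (K : fieldType) (n m : nat).

(* x |-> x *m phi induces an isomorphism from T / T' onto K^m. *)
Definition quotient_iso (T T' : 'rV[K]_n -> Prop) (phi : 'M[K]_(n, m)) : Prop :=
  (forall x, T' x <-> T x /\ x *m phi = 0)
  /\ (forall y : 'rV[K]_m, exists2 x, T x & x *m phi = y).

Definition pullback (phi : 'M[K]_(n, m)) (g : {mpoly K[m]}) : {mpoly K[n]} :=
  g \mPo [tuple \sum_(i < n) phi i j *: 'X_i | j < m].

(* If J is the ideal of a subscheme of T, this is the ideal of its scheme
   theoretic image in T / T', in the coordinates given by phi. *)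
Definition image_ideal (phi : 'M[K]_(n, m)) (J : {mpoly K[n]} -> Prop)
    (g : {mpoly K[m]}) : Prop :=
  J (pullback phi g).

End LinearQuotient.

Section Grassmannian.
Variable K : fieldType.

(* The coordinates are indexed by the increasing k-tuples of columns. *)
Definition plucker (k n : nat) (A : 'M[K]_(k, n)) (i : 'I_'C(n, k)) : K :=
  \det (colsub (tnth (enum_val
                  (cast_ord (esym (card_ltn_sorted_tuples k n)) i))) A).

(* The affine cone over G(k, n) in its Pluecker embedding. *)
Definition grassmannian_cone (k n : nat) (y : 'rV[K]_('C(n, k))) : Prop :=
  exists (A : 'M[K]_(k, n)) (c : K),
    \rank A = k /\ y = c *: \row_i plucker A i.

Definition grassmannian_ideal (k n : nat) : {mpoly K['C(n, k)]} -> Prop :=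
  vanishing_ideal (@grassmannian_cone k n).

Definition frame_mx (k n : nat) (b : k.-tuple 'M[K]_n) : 'M[K]_(k, n * n) :=
  \matrix_(i < k) mxvec (tnth b i).

Definition vanishes_at (k n : nat) (F : {mpoly K['C(n * n, k)]})
    (U : {vspace 'M[K]_n}) : Prop :=
  forall b : k.-tuple 'M[K]_n, basis_of U b -> F.@[plucker (frame_mx b)] = 0.

(* Zariski closure in G(k, L), which is closed in G(k, gl_n), of a set S of
   k-dimensional subspaces of L. *)
Definition zariski_closure (k n : nat) (L : {vspace 'M[K]_n})
    (S : {vspace 'M[K]_n} -> Prop) (U : {vspace 'M[K]_n}) : Prop :=
  [/\ (U <= L)%VS, \dim U = k
    & forall (d : nat) (F : {mpoly K['C(n * n, k)]}), F \is d.-homog ->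
        (forall U', S U' -> vanishes_at F U') -> vanishes_at F U].

(* If e is a basis of p and e ++ w a basis of L, this identifies the affine
   space of k x m matrices x with the open chart of G(k, L) of the complements
   of <<w>>; the origin corresponds to p. *)
Definition chart (k m n : nat) (e : k.-tuple 'M[K]_n) (w : m.-tuple 'M[K]_n)
    (x : 'rV[K]_(k * m)) : {vspace 'M[K]_n} :=
  span [tuple tnth e i + \sum_(j < m) vec_mx x i j *: tnth w j | i < k].

End Grassmannian.

Section Reductions.
Variable K : fieldType.

Definition sl (n : nat) : {vspace 'M[K]_n} :=
  lker (linfun (fun x : 'M[K]_n => \tr x : K^o)).

Lemma mem_sl (n : nat) (x : 'M[K]_n) : (x \in sl n) = (\tr x == 0).
Proof. by rewrite memv_ker lfunE. Qed.

(* The columns of P form the diagonalizing basis. *)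
Definition cartan (n : nat) (U : {vspace 'M[K]_n}) : Prop :=
  exists2 P : 'M[K]_n, P \in unitmx &
    forall x, (x \in U) = (x \in sl n) && is_diag_mx (invmx P *m x *m P).

Definition Red (n : nat) : {vspace 'M[K]_n} -> Prop :=
  zariski_closure n.-1 (sl n) (@cartan n).

(* Matrices act on column vectors. *)
Definition line_orbit (n : nat) (U : {vspace 'M[K]_n}) : Prop :=
  exists2 V : {vspace 'cV[K]_n}, \dim V = 1%N &
    forall x : 'M[K]_n, x \in U <->
      (forall u : 'cV[K]_n, x *m u \in V) /\
      (forall u : 'cV[K]_n, u \in V -> x *m u = 0).

End Reductions.

(* Main.v *)
(* Near a point of O'_3 every 3-space U in Red(4), being commutative, spans together with 1 a
   commutative quartic algebra acting regularly on a row vector e_0: it has a basis x_1, x_2, x_3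
   with e_0 x_j = e_j. Its structure constants, modulo translations of the basis by scalars, form a
   skew form omega on the 6-dimensional space of quadratic monomials (i, a), as in Bhargava's
   parametrization of quartic rings; commutativity turns into the Pluecker relations for omega, so
   that omega takes values in the cone over G(2, 6). The linear part phi of omega at p is the
   projection T_p Red(4) -> T_p Red(4) / T_p O'_3. If g vanishes on the cone over G(2, 6), then
   g o omega vanishes on Red(4), and its initial form is g o phi for homogeneous g. Conversely, each
   y = a /\ b defines a quartic algebra whose 3-space of traceless elements is a limit of Cartan
   subalgebras; scaling a by t gives a curve in Red(4) whose tangent vector at p is mapped to y by
   phi, and so elements of the tangent cone ideal vanish at y. *)
Require Import Defs.
From HB Require Import structures.
From mathcomp Require Import all_boot all_order all_algebra.
From mathcomp Require Import reals complex.
From mathcomp Require Import mpoly.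
From mathcomp Require Import perm separable ring.

Set Implicit Arguments.
Unset Strict Implicit.
Unset Printing Implicit Defensive.

Import GRing.Theory.
Local Open Scope ring_scope.

(** No equations of Red(4) are computed. The numbers match because the symmetric structure constants
    of three generators have 18 parameters, translations take away 3, and the remaining 15 form the
    exterior square of the 6-dimensional space of quadratic monomials. A form a /\ b is a pencil of
    conics. Its algebra is a limit of split ones since a straight path joins (a, b) to a pencil
    through four general points, whose algebra is K^4: the discriminant of a suitable element is a
    polynomial along the path and is nonzero at that end. The scalar parts of the products are
    invisible to omega. Taking traces determines them, and their associativity follows from that of
    the linear parts. Frames can be normalized only where a determinant is nonzero, and curves have
    denominators in the chart; adjugates and multiplication by that determinant keep all functions
    polynomial. *)

(** * Algebras of functions and their closure under matrix operations *)

Section FunctionAlgebras.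
Variables (K : comNzRingType) (T : Type).
Implicit Types (S : (T -> K) -> Prop) (f g : T -> K).

(** The domain [T] is arbitrary so that the same closure lemmas serve for polynomials in one
    parameter t and for polynomials in the chart coordinates. Closure under [=1] replaces functional
    extensionality. *)
Definition fun_subalgebra S :=
  [/\ forall c, S (fun=> c),
      forall f g, S f -> S g -> S (fun t => f t + g t),
      forall f g, S f -> S g -> S (fun t => f t * g t)
    & forall f g, f =1 g -> S f -> S g].

Variable S : (T -> K) -> Prop.
Hypothesis algS : fun_subalgebra S.

Lemma fsubalgC c : S (fun=> c).
Proof. by case: algS => SC _ _ _; apply: SC. Qed.

Lemma fsubalgD f g : S f -> S g -> S (fun t => f t + g t).
Proof. by case: algS => _ SD _ _; apply: SD. Qed.

Lemma fsubalgM f g : S f -> S g -> S (fun t => f t * g t).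
Proof. by case: algS => _ _ SM _; apply: SM. Qed.

Lemma fsubalg_ext f g : f =1 g -> S f -> S g.
Proof. by case: algS => _ _ _ Sext; apply: Sext. Qed.

Lemma fsubalgZ c f : S f -> S (fun t => c * f t).
Proof. by move=> Sf; apply: fsubalgM => //; apply: fsubalgC. Qed.

Lemma fsubalgN f : S f -> S (fun t => - f t).
Proof.
by move=> Sf; apply: fsubalg_ext (fsubalgZ (-1) Sf) => t; rewrite mulN1r.
Qed.

Lemma fsubalgB f g : S f -> S g -> S (fun t => f t - g t).
Proof. by move=> Sf Sg; apply: fsubalgD => //; apply: fsubalgN. Qed.

Lemma fsubalg_sum (I : Type) (r : seq I) (P : pred I) (F : I -> T -> K) :
  (forall i, S (F i)) -> S (fun t => \sum_(i <- r | P i) F i t).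
Proof.
move=> SF; elim: r => [|i r IHr].
  by apply: fsubalg_ext (fsubalgC 0) => t; rewrite big_nil.
case Pi: (P i); last first.
  by apply: fsubalg_ext IHr => t; rewrite big_cons Pi.
by apply: fsubalg_ext (fsubalgD (SF i) IHr) => t; rewrite big_cons Pi.
Qed.

Lemma fsubalg_prod (I : Type) (r : seq I) (P : pred I) (F : I -> T -> K) :
  (forall i, S (F i)) -> S (fun t => \prod_(i <- r | P i) F i t).
Proof.
move=> SF; elim: r => [|i r IHr].
  by apply: fsubalg_ext (fsubalgC 1) => t; rewrite big_nil.
case Pi: (P i); last first.
  by apply: fsubalg_ext IHr => t; rewrite big_cons Pi.
by apply: fsubalg_ext (fsubalgM (SF i) IHr) => t; rewrite big_cons Pi.
Qed.

Lemma fsubalgX f k : S f -> S (fun t => f t ^+ k).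
Proof.
move=> Sf; have := @fsubalg_prod _ (index_enum 'I_k) xpredT (fun=> f) (fun=> Sf).
by apply: fsubalg_ext => t; rewrite prodr_const card_ord.
Qed.

Lemma fsubalg_det k (A : T -> 'M[K]_k) :
  (forall i j, S (fun t => A t i j)) -> S (fun t => \det (A t)).
Proof.
move=> SA; apply: fsubalg_sum => s.
by apply: fsubalgM; [apply: fsubalgC | apply: fsubalg_prod].
Qed.

Lemma fsubalg_mulmx m k l (A : T -> 'M[K]_(m, k)) (B : T -> 'M[K]_(k, l)) i j :
  (forall i j, S (fun t => A t i j)) -> (forall i j, S (fun t => B t i j)) ->
  S (fun t => (A t *m B t) i j).
Proof.
move=> SA SB.
have: S (fun t => \sum_k0 A t i k0 * B t k0 j).
  by apply: fsubalg_sum => k0; apply: fsubalgM.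
by apply: fsubalg_ext => t; rewrite mxE.
Qed.

Lemma fsubalg_adj k (A : T -> 'M[K]_k) i j :
  (forall i j, S (fun t => A t i j)) -> S (fun t => (\adj (A t)) i j).
Proof.
move=> SA.
have: S (fun t => cofactor (A t) j i).
  apply: fsubalgM; first exact: fsubalgC.
  apply: fsubalg_det => i' j'.
  by apply: fsubalg_ext (SA (lift j i') (lift i j')) => t; rewrite !mxE.
by apply: fsubalg_ext => t; rewrite mxE.
Qed.

Lemma fsubalg_meval n (F : {mpoly K[n]}) (v : T -> 'I_n -> K) :
  (forall i, S (fun t => v t i)) -> S (fun t => F.@[v t]).
Proof.
move=> Sv.
have: S (fun t => \sum_(m <- msupp F) F@_m * \prod_i v t i ^+ m i).
  apply: fsubalg_sum => m; apply: fsubalgZ.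
  by apply: fsubalg_prod => i; apply: fsubalgX.
by apply: fsubalg_ext => t; rewrite mevalE.
Qed.

End FunctionAlgebras.

(** * Polynomial functions in one and several variables *)

Section PolynomialFunctions.
Variable K : numFieldType.

Definition polyfun (f : K -> K) := exists p : {poly K}, forall t, f t = p.[t].

Lemma polyfun_subalgebra : fun_subalgebra polyfun.
Proof.
split=> [c | f g [p Ep] [q Eq] | f g [p Ep] [q Eq] | f g Efg [p Ep]].
- by exists c%:P => t; rewrite hornerC.
- by exists (p + q) => t; rewrite Ep Eq hornerD.
- by exists (p * q) => t; rewrite Ep Eq hornerM.
by exists p => t; rewrite -Efg.
Qed.

Lemma polyfun_id : polyfun id.
Proof. by exists 'X => t; rewrite hornerX. Qed.

(** In characteristic 0 the integers 0, 1, 2, ... supply more roots than the degree allows. *)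
Lemma horner_eq0 (p : {poly K}) : (forall t, p.[t] = 0) -> p = 0.
Proof.
move=> p0.
pose s : seq K := [seq i%:R | i <- iota 0 (size p)].
apply: (@roots_geq_poly_eq0 _ p s).
- by apply/allP => t _; rewrite /root p0.
- rewrite map_inj_uniq ?iota_uniq // => i j /eqP.
  by rewrite Num.Theory.eqr_nat => /eqP.
by rewrite size_map size_iota.
Qed.

Lemma horner_inj (p q : {poly K}) : (forall t, p.[t] = q.[t]) -> p = q.
Proof.
move=> pq; apply/eqP; rewrite -subr_eq0; apply/eqP/horner_eq0 => t.
by rewrite hornerD hornerN pq subrr.
Qed.

(** Density on the line: the product of the two polynomials vanishes everywhere, and polynomials
    form a domain. *)
Lemma polyfun_eq0 (f g : K -> K) t0 : polyfun f -> polyfun g -> g t0 != 0 ->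
  (forall t, g t != 0 -> f t = 0) -> forall t, f t = 0.
Proof.
move=> [p Ep] [q Eq] g0 fg0.
have pq0: p * q = 0.
  apply: horner_eq0 => t; rewrite hornerM -Ep -Eq.
  by have [-> | /fg0->] := eqVneq (g t) 0; rewrite (mulr0, mul0r).
have /eqP := pq0; rewrite mulf_eq0 => /orP[] /eqP pq00 t.
  by rewrite Ep pq00 horner0.
by rewrite Eq pq00 horner0 eqxx in g0.
Qed.

Variable n : nat.
Implicit Types (f g : {mpoly K[n]}) (x : 'rV[K]_n) (Z : 'rV[K]_n -> Prop).

Definition mpolyfun (F : 'rV[K]_n -> K) :=
  exists f : {mpoly K[n]}, forall x, F x = f.@[x 0].

Lemma mpolyfun_subalgebra : fun_subalgebra mpolyfun.
Proof.
split=> [c | f g [p Ep] [q Eq] | f g [p Ep] [q Eq] | f g Efg [p Ep]].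
- by exists c%:MP => x; rewrite mevalC.
- by exists (p + q) => x; rewrite Ep Eq mevalD.
- by exists (p * q) => x; rewrite Ep Eq mevalM.
by exists p => x; rewrite -Efg.
Qed.

Lemma mpolyfun_coord i : mpolyfun (fun x => x 0 i).
Proof. by exists 'X_i => x; rewrite mevalXU. Qed.

Lemma meval_dhomog_scale d f (v : 'I_n -> K) t : f \is d.-homog ->
  f.@[fun i => t * v i] = t ^+ d * f.@[v].
Proof.
move=> /dhomogP hf; rewrite !mevalE big_distrr /= !big_seq.
apply: eq_bigr => m /hf <-; rewrite mulrCA; congr (_ * _).
rewrite /= mdegE -prodrXr -big_split /=.
by apply: eq_bigr => i _; rewrite exprMn.
Qed.

Lemma meval_scale f (v : 'I_n -> K) t :
  f.@[fun i => t * v i] =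
    \sum_(d < msize f) t ^+ d * (pihomog mdeg d f).@[v].
Proof.
rewrite {1}(pihomog_partitionE (leqnn (msize f))) raddf_sum /=.
by apply: eq_bigr => d _; rewrite (meval_dhomog_scale _ _ (pihomogP _ _ _)).
Qed.

End PolynomialFunctions.

(** Uniqueness of base [D] expansions, which makes Kronecker substitution injective on exponents. *)
Lemma digits_inj n D (a b : 'I_n -> nat) :
  (forall i, a i < D)%N -> (forall i, b i < D)%N ->
  (\sum_(i < n) a i * D ^ i = \sum_(i < n) b i * D ^ i)%N -> a =1 b.
Proof.
elim: n a b => [|n IHn] a b aD bD; first by move=> _ [].
have step (c : 'I_n.+1 -> nat) : (\sum_(i < n.+1) c i * D ^ i =
    c ord0 + (\sum_(i < n) c (lift ord0 i) * D ^ i) * D)%N.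
  rewrite big_ord_recl expn0 muln1 big_distrl /=; congr addn.
  by apply: eq_bigr => i _; rewrite expnSr mulnA.
have D0 : (0 < D)%N by apply: leq_trans (aD ord0).
rewrite !step => eq_ab; have: (a ord0 = b ord0)%N.
  have /(congr1 (modn^~ D)) := eq_ab.
  by rewrite /= ![(_ ord0 + _)%N]addnC !modnMDl !modn_small.
have: (\sum_(i < n) a (lift ord0 i) * D ^ i =
       \sum_(i < n) b (lift ord0 i) * D ^ i)%N.
  have /(congr1 (divn^~ D)) := eq_ab.
  by rewrite /= ![(_ ord0 + _)%N]addnC !divnMDl // !divn_small // !addn0.
move=> /IHn-/(_ (fun i => aD _) (fun i => bD _)) eq_lift eq0 i.
by case: (unliftP ord0 i) => [j|] ->; [apply: eq_lift | apply: eq0].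
Qed.

(** * Initial forms, tangent cones and tangent vectors of curves *)

Section InitialForms.
Variables (K : numFieldType) (n : nat).
Implicit Types (f g : {mpoly K[n]}) (x : 'rV[K]_n) (Z : 'rV[K]_n -> Prop).

(* Kronecker substitution: x_i = t ^ (D ^ i) separates the monomials of degree < D. *)
Lemma meval_eq0 f : (forall v, f.@[v] = 0) -> f = 0.
Proof.
move=> f0; pose D := msize f; pose k (m : 'X_{1..n}) := (\sum_i m i * D ^ i)%N.
have k_inj m1 m2 : m1 \in msupp f -> m2 \in msupp f -> k m1 = k m2 -> m1 = m2.
  move=> f1 f2 k12; apply/mnmP; apply: digits_inj k12 => i;
    [move: f1 | move: f2] => /msize_mdeg_lt; apply: leq_ltn_trans;
    by rewrite mdegE (bigD1 i) //= leq_addr.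
pose p : {poly K} := \sum_(m <- msupp f) f@_m *: 'X^(k m).
have p0: p = 0.
  apply: horner_eq0 => t; rewrite -[RHS](f0 (fun i : 'I_n => t ^+ (D ^ i))).
  rewrite mevalE horner_sum; apply: eq_bigr => m _.
  rewrite hornerZ hornerXn -prodrXr; congr (_ * _).
  by apply: eq_bigr => i _; rewrite -exprM mulnC.
apply/mpolyP => m; rewrite mcoeff0.
case: (boolP (m \in msupp f)) => [fm|]; last by move/memN_msupp_eq0.
have := congr1 (fun q : {poly K} => q`_(k m)) p0.
rewrite coef0 coef_sum (bigD1_seq m) ?msupp_uniq //= coefZ coefXn eqxx mulr1.
rewrite big1_seq ?addr0 // => m' /andP[m'm fm']; rewrite coefZ coefXn.
case: eqP => [/k_inj E | _]; last by rewrite mulr0.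
by rewrite -E ?eqxx in m'm.
Qed.

(** The restriction of [f] to the line through the origin and [v]; its coefficients are the values
    at [v] of the homogeneous components. *)
Definition scale_poly f (v : 'I_n -> K) : {poly K} :=
  \poly_(d < msize f) (pihomog mdeg d f).@[v].

Lemma pihomog_msize f d : (msize f <= d)%N -> pihomog mdeg d f = 0.
Proof.
move=> fd; rewrite pihomogE big1_seq // => m /andP[/eqP md /msize_mdeg_lt].
by rewrite -[mdeg m]/((mdeg : measure n) m) md ltnNge fd.
Qed.

Lemma coef_scale_poly f v d : (scale_poly f v)`_d = (pihomog mdeg d f).@[v].
Proof.
by rewrite coef_poly; case: ltnP => // /pihomog_msize->; rewrite meval0.
Qed.

Lemma horner_scale_poly f v t : (scale_poly f v).[t] = f.@[fun i => t * v i].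
Proof.
rewrite meval_scale horner_poly; apply: eq_bigr => d _; exact: mulrC.
Qed.

(** An initial form is recognized on lines through the origin. The case g = 0 is included, as
    [initial_form] asks only that the components below degree d vanish. *)
Lemma initial_formI f g d :
  (forall x, exists2 h, polyfun h &
     h 0 = g.@[x 0] /\ forall t, f.@[fun i => t * x 0 i] = t ^+ d * h t) ->
  initial_form f g.
Proof.
move=> fg; have coefs d' x : (pihomog mdeg d' f).@[x 0] =
    if (d' < d)%N then 0 else if d' == d then g.@[x 0]
    else (pihomog mdeg d' f).@[x 0].
  have [h [q Eq] [h0 fh]] := fg x.
  have E : scale_poly f (x 0) = 'X^d * q.
    by apply: horner_inj => t; rewrite horner_scale_poly fh hornerM hornerXn Eq.
  rewrite -coef_scale_poly E coefXnM; case: ltnP => // _.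
  by case: eqP => // ->; rewrite subnn -horner_coef0 -Eq.
have vrow (v : 'I_n -> K) : (\row_i v i) 0 =1 v by move=> i; rewrite mxE.
exists d; split=> [d' d'd|].
  by apply: meval_eq0 => v; rewrite -(meval_eq _ (vrow v)) coefs d'd.
apply/eqP; rewrite -subr_eq0; apply/eqP/meval_eq0 => v.
by rewrite -(meval_eq _ (vrow v)) mevalB coefs ltnn eqxx subrr.
Qed.

(** Along the curve t y(t) / u(t), the function f is t^d g(y(0)) to leading order, so g(y(0)) = 0 as
    soon as f vanishes on the curve. The denominator u must be cleared first. *)
Lemma initial_form_curve f g (y : K -> 'I_n -> K) (u : K -> K) :
  initial_form f g -> (forall i, polyfun (fun t => y t i)) -> polyfun u ->
  u 0 = 1 -> (forall t, u t != 0 -> f.@[fun i => t / u t * y t i] = 0) ->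
  g.@[y 0] = 0.
Proof.
move=> [d [f0 ->]] poly_y poly_u u0 fy.
have alg := polyfun_subalgebra K; have poly_id := polyfun_id K.
(* This is f on the curve multiplied by u^N / t^d with N = [msize f], larger than every degree in f;
   hence a polynomial in t, whose value at 0 is g(y(0)). *)
pose h t := \sum_(e < msize f | (d <= e)%N)
  t ^+ (e - d) * u t ^+ (msize f - e) * (pihomog mdeg e f).@[y t].
have poly_h : polyfun h.
  apply: fsubalg_sum => // e; apply: fsubalgM => //.
    by apply: fsubalgM => //; apply: fsubalgX.
  exact: fsubalg_meval.
have hE t : u t != 0 ->
    t ^+ d * h t = u t ^+ msize f * f.@[fun i => t / u t * y t i].
  move=> ut; rewrite meval_scale !big_distrr /=.
  rewrite [RHS](bigID (fun e : 'I_ _ => d <= e)%N) /=.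
  rewrite [X in _ = _ + X]big1 ?addr0 => [|e]; last first.
    by rewrite -ltnNge => /f0->; rewrite meval0 !mulr0.
  apply: eq_bigr => e de; rewrite !mulrA; congr (_ * _).
  rewrite -exprD subnKC // [RHS]mulrC exprMn exprVn -mulrA; congr (_ * _).
  by rewrite expfB_cond ?(negPf ut) //= ?add0n 1?mulrC // ltnW.
have h0 t : h t = 0.
  (* Density is used twice: to pass the zeros of u, and then to divide by s^d. *)
  have tdh : forall s, s ^+ d * h s = 0.
    apply: (@polyfun_eq0 _ _ u 0) => //.
    - by apply: fsubalgM => //; apply: fsubalgX.
    - by rewrite u0 oner_eq0.
    by move=> s us; rewrite hE // fy // mulr0.
  apply: (@polyfun_eq0 _ h (fun s => s ^+ d) 1) => //.
  - exact: fsubalgX.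
  - by rewrite expr1n oner_eq0.
  by move=> s sd; move/eqP: (tdh s); rewrite mulf_eq0 (negPf sd) => /eqP.
have [df | fd] := ltnP d (msize f); last by rewrite pihomog_msize // meval0.
rewrite -[RHS](h0 0) /h (bigD1 (Ordinal df)) //= subnn expr0 mul1r u0 expr1n mul1r.
rewrite big1 ?addr0 // => e /andP[de ne].
rewrite expr0n subn_eq0 leqNgt ltn_neqAle de andbT eq_sym.
by move: ne; rewrite -val_eqE /= => ->; rewrite /= !mul0r.
Qed.

Lemma meval_pihomog0 f v : (pihomog mdeg 0 f).@[v] = f.@[fun=> 0].
Proof.
rewrite -coef_scale_poly -horner_coef0 horner_scale_poly.
by apply: meval_eq => i; rewrite mul0r.
Qed.

(** By linearity this is a check on monomials: only those of degree 1 have a partial derivative that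
    is nonzero at the origin. *)
Lemma meval_pihomog1 f v :
  (pihomog mdeg 1 f).@[v] = \sum_(i < n) (f^`M(i)).@[fun=> 0] * v i.
Proof.
have lin (c : K) f1 f2 :
  (pihomog mdeg 1 f1).@[v] = \sum_(i < n) (f1^`M(i)).@[fun=> 0] * v i ->
  (pihomog mdeg 1 f2).@[v] = \sum_(i < n) (f2^`M(i)).@[fun=> 0] * v i ->
  (pihomog mdeg 1 (c *: f1 + f2)).@[v] =
    \sum_(i < n) ((c *: f1 + f2)^`M(i)).@[fun=> 0] * v i.
  move=> E1 E2; rewrite linearP /= mevalD mevalZ E1 E2 big_distrr -big_split.
  apply: eq_bigr => i _ /=.
  by rewrite linearP /= mevalD mevalZ mulrDl mulrA.
rewrite [f]mpolyE; elim: (msupp f) => [|m s IHs].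
  by rewrite big_nil linear0 meval0 big1 // => i _; rewrite linear0 meval0 mul0r.
rewrite big_cons; apply: lin => // {s IHs}.
rewrite pihomogX -[(mdeg : measure n) m]/(mdeg m).
under eq_bigr => i _ do rewrite mderivX mevalZ mevalX.
case: ifP => [/eqP/esym/eqP | m1].
  rewrite eq_sym mdeg_eq1 => /existsP[i /eqP->]; rewrite mevalXU.
  rewrite (bigD1 i) //= mnm1E eqxx mul1r big1 => [|j _]; last first.
    by rewrite mnmBE !mnm1E subnn expr0.
  rewrite mul1r big1 ?addr0 // => j /negPf ij.
  by rewrite mnm1E eq_sym ij !mul0r.
(* If X_i occurs in a monomial of degree other than 1, another factor survives differentiation and
   vanishes at the origin. *)
rewrite meval0 big1 // => i _; have [-> | mi] := posnP (m i).
  by rewrite !mul0r.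
have : mdeg (m - U_(i))%MM != 0%N.
  apply: contraFN m1 => /eqP E.
  have /(congr1 (@mdeg n)) : m = (m - U_(i) + U_(i))%MM.
    by rewrite submK // lep1mP -lt0n.
  by rewrite mdegD E mdeg1 => ->.
rewrite mdeg_eq0 => /eqP ne; have [j mj] : exists j, (m - U_(i))%MM j != 0%N.
  apply/existsP; apply: contra_notT ne; rewrite negb_exists => /forallP z.
  by apply/mnmP => j; move: (z j); rewrite negbK => /eqP->; rewrite mnm0E.
by rewrite [\prod_ _ _](bigD1 j) //= expr0n (negPf mj) mul0r mulr0 mul0r.
Qed.

(** Here h(0) is the derivative of f at the origin in the direction x. *)
Lemma tangent_space_line Z x f (h : K -> K) :
  tangent_space Z x -> vanishing_ideal Z f -> polyfun h ->
  (forall t, f.@[fun i => t * x 0 i] = t * h t) -> h 0 = 0.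
Proof.
move=> /[apply] fx [q Eq] fh; move: fx; rewrite -meval_pihomog1 => fx.
have E : scale_poly f (x 0) = 'X * q.
  by apply: horner_inj => t; rewrite horner_scale_poly fh hornerM hornerX Eq.
by rewrite -[RHS]fx -coef_scale_poly E coefXM Eq horner_coef0.
Qed.

Section Curves.
Variables (Z : 'rV[K]_n -> Prop) (y : K -> 'I_n -> K) (u : K -> K).
Hypothesis poly_y : forall i, polyfun (fun t => y t i).
Hypothesis poly_u : polyfun u.
Hypothesis u0 : u 0 = 1.
Hypothesis Zy : forall t, u t != 0 -> Z (\row_i (t / u t * y t i)).

Lemma vanishing_ideal_curve f t : vanishing_ideal Z f -> u t != 0 ->
  f.@[fun i => t / u t * y t i] = 0.
Proof.
by move=> Zf /Zy/Zf <-; apply: meval_eq => i; rewrite mxE.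
Qed.

Lemma tangent_cone_curve g : tangent_cone_ideal Z g -> g.@[y 0] = 0.
Proof.
move=> [s [sZ ->]]; rewrite raddf_sum big1_seq //= => -[a g'] /sZ /= [f Zf fg].
rewrite mevalM (initial_form_curve fg poly_y poly_u u0) ?mulr0 // => t ut.
exact: vanishing_ideal_curve.
Qed.

(** The curve passes through the origin at t = 0, so a function that vanishes on Z has no constant
    term and its linear part can play the initial form of degree 1. *)
Lemma tangent_space_curve : tangent_space Z (\row_i y 0 i).
Proof.
move=> f Zf; under eq_bigr => i _ do rewrite mxE.
rewrite -meval_pihomog1.
have fy t : u t != 0 -> f.@[fun i => t / u t * y t i] = 0.
  exact: vanishing_ideal_curve.
apply: (@initial_form_curve f (pihomog mdeg 1 f) y u) => //; exists 1%N; split=> // -[] // _.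
apply: meval_eq0 => v; rewrite meval_pihomog0 -[RHS](fy 0) ?u0 ?oner_eq0 //.
by apply: meval_eq => i; rewrite mul0r mul0r.
Qed.

End Curves.

End InitialForms.

(** * Determinants and Pluecker coordinates *)

Lemma det_mx22 (R : comNzRingType) (A : 'M[R]_2) :
  \det A = A ord0 ord0 * A ord_max ord_max - A ord0 ord_max * A ord_max ord0.
Proof.
rewrite (expand_det_row _ ord0) !big_ord_recl big_ord0 addr0 /cofactor.
rewrite !det_mx11 !mxE /= expr0 expr1 mul1r mulN1r mulrN.
by congr (_ * A _ _ - A _ _ * A _ _); apply: val_inj.
Qed.

(** The indices are variables with prescribed values, so that the expansion applies to whatever form
    the ordinals have at the place of use. *)
Lemma det_mx33 (R : comNzRingType) (A : 'M[R]_3) (i j k : 'I_3) :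
  i = 0 :> nat -> j = 1%N :> nat -> k = 2%N :> nat ->
  \det A = A i i * (A j j * A k k - A j k * A k j)
         - A i j * (A j i * A k k - A j k * A k i)
         + A i k * (A j i * A k j - A j j * A k i).
Proof.
move=> i0 j1 k2.
have liftE (a : 'I_3) (b : 'I_2) (c : 'I_3) : bump a b = c :> nat -> lift a b = c.
  by move=> E; apply: val_inj.
rewrite (expand_det_row _ i) !big_ord_recl big_ord0 addr0 /cofactor !det_mx22 !mxE.
have -> : ord0 = i :> 'I_3 by apply: val_inj.
have -> : lift i ord0 = j by apply: liftE; rewrite i0 j1.
have -> : lift i ord_max = k by apply: liftE; rewrite i0 k2.
have -> : lift i (lift ord0 ord0) = k by apply: liftE; rewrite i0 k2.
have -> : lift j ord0 = i by apply: liftE; rewrite i0 j1.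
have -> : lift j ord_max = k by apply: liftE; rewrite j1 k2.
have -> : lift k ord0 = i by apply: liftE; rewrite i0 k2.
have -> : lift k ord_max = j by apply: liftE; rewrite j1 k2.
by rewrite i0 j1 k2 /= addn0 expr0 expr1 -signr_odd /= expr0; ring.
Qed.

Section Pluecker.
Variables (K : fieldType) (k n : nat).
Implicit Types A : 'M[K]_(k, n).

Definition pluecker_tuple (i : 'I_'C(n, k)) : k.-tuple 'I_n :=
  enum_val (cast_ord (esym (card_ltn_sorted_tuples k n)) i).

Lemma pluecker_tuple_sorted i : sorted ltn (map val (pluecker_tuple i)).
Proof.
by have := enum_valP (cast_ord (esym (card_ltn_sorted_tuples k n)) i); rewrite inE.
Qed.

Lemma pluecker_tuple_onto (t : k.-tuple 'I_n) :
  sorted ltn (map val t) -> exists i, pluecker_tuple i = t.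
Proof.
move=> st; have t_in : t \in [set t : k.-tuple 'I_n | sorted ltn (map val t)].
  by rewrite inE.
exists (cast_ord (card_ltn_sorted_tuples k n) (enum_rank_in t_in t)).
by rewrite /pluecker_tuple cast_ord_comp cast_ord_id enum_rankK_in.
Qed.

Lemma pluecker_mull (M : 'M[K]_k) A i : plucker (M *m A) i = \det M * plucker A i.
Proof. by rewrite /plucker -mulmx_colsub det_mulmx. Qed.

(** A repeated column gives 0; otherwise sorting the columns gives a Pluecker coordinate up to the
    sign of the sorting permutation. *)
Lemma det_colsub_pluecker (f : 'I_k -> 'I_n) :
  (forall A, \det (colsub f A) = 0) \/
  exists i (c : K), forall A, \det (colsub f A) = c * plucker A i.
Proof.
have [/injectiveP f_inj | /injectivePn[i [j ij fij]]] := boolP (injectiveb f); last first.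
  left=> A; rewrite -det_tr; apply: (determinant_alternate ij) => l.
  by rewrite !mxE fij.
right; pose tf := [tuple f i | i < k].
pose le_ord (a b : 'I_n) := (val a <= val b)%N.
have size_st : size (sort le_ord tf) == k by rewrite size_sort size_tuple.
pose t := Tuple size_st.
have st : sorted ltn (map val t).
  rewrite ltn_sorted_uniq_leq map_inj_uniq ?sort_uniq; last exact: val_inj.
  rewrite sorted_map sort_sorted; last by move=> a b; apply: leq_total.
  by rewrite map_inj_uniq ?enum_uniq.
have [i ti] := pluecker_tuple_onto st.
have /tuple_permP[s Es] : perm_eq tf t by rewrite perm_sym perm_sort.
have fE l : f l = tnth t (s l).
  have -> : f l = tnth tf l by rewrite tnth_mktuple.
  by rewrite (tnth_nth (f l)) Es -tnth_nth tnth_mktuple.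
exists i, ((-1) ^+ (s^-1)%g) => A.
rewrite /plucker -/(pluecker_tuple i) ti mulrC -det_perm -det_mulmx -col_permE.
by congr (\det _); apply/matrixP => a b; rewrite !mxE fE.
Qed.

(* Existence half of the Cauchy-Binet formula. *)
Lemma det_mulmx_pluecker (M : 'M[K]_(n, k)) :
  exists2 F : {mpoly K['C(n, k)]}, F \is 1.-homog &
    forall A, F.@[plucker A] = \det (A *m M).
Proof.
have det_sub (f : {ffun 'I_k -> 'I_n}) :
    exists F : {mpoly K['C(n, k)]}, F \is 1.-homog /\
    forall A, F.@[plucker A] = \det (colsub f A).
  have [f0 | [i [c fc]]] := det_colsub_pluecker f.
    exists 0; split=> [|A]; last by rewrite meval0 f0.
    exact: rpred0.
  exists (c *: 'X_i); split=> [|A]; last by rewrite mevalZ mevalXU fc.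
  by rewrite rpredZ ?dhomogX /= ?mdeg1.
have [F FP] := fin_all_exists det_sub.
(* Multilinear expansion of the product: f chooses the summation index in each of the k columns. *)
exists (\sum_(f : {ffun 'I_k -> 'I_n}) (\prod_j M (f j) j) *: F f).
  by apply: rpred_sum => f _; apply: rpredZ; have [] := FP f.
move=> A; rewrite raddf_sum /= -det_tr trmx_mul.
transitivity (\sum_(s : 'S_k) \sum_(f : {ffun 'I_k -> 'I_n})
   (-1) ^+ s * \prod_i (M (f i) i * A (s i) (f i))); last first.
  apply: eq_bigr => s _; rewrite -big_distrr /=; congr (_ * _).
  rewrite -(bigA_distr_bigA (fun i l => M l i * A (s i) l)).
  apply: eq_bigr => i _; rewrite !mxE.
  by apply: eq_bigr => l _; rewrite !mxE.
rewrite exchange_big; apply: eq_bigr => f _ /=.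
rewrite mevalZ; have [_ ->] := FP f; rewrite -det_tr big_distrr /=.
apply: eq_bigr => s _; rewrite mulrCA big_split /=; congr (_ * (_ * _)).
by apply: eq_bigr => i _; rewrite !mxE.
Qed.

End Pluecker.

Lemma row_free_frame (K : fieldType) n k (b : k.-tuple 'M[K]_n) :
  free b -> row_free (frame_mx b).
Proof.
move=> /freeP fb; rewrite -kermx_eq0; apply/eqP/row_matrixP => i.
rewrite row0; set v := row i _.
have: v *m frame_mx b = 0 by apply/sub_kermxP; apply: row_sub.
rewrite mulmx_sum_row => v0; apply/rowP => j; rewrite [RHS]mxE.
apply: (fb (fun j => v 0 j)).
apply: (can_inj mxvecK); rewrite linear_sum linear0 -[RHS]v0.
apply: eq_bigr => l _; rewrite linearZ /= rowK; congr (_ *: mxvec _).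
by rewrite (tnth_nth 0).
Qed.

Lemma mem_basis_tnth (K : fieldType) (V : vectType K) k (U : {vspace V})
  (b : k.-tuple V) i : basis_of U b -> tnth b i \in U.
Proof. by move=> bU; apply: (basis_mem bU); apply: mem_tnth. Qed.

Lemma basis_of_span (K : fieldType) (V : vectType K) k (U : {vspace V}) (b : k.-tuple V) :
  basis_of U b -> U = <<b>>%VS.
Proof. by move=> /span_basis. Qed.

(* Commutativity of the span of b1, b2, b3 is linear in the Pluecker coordinates:
   it says that the 3-form l /\ (x, y |-> [x, y]_(a, b)) vanishes for every
   linear form l. *)
Lemma zariski_closure_comm (K : fieldType) n (L : {vspace 'M[K]_n})
    (S : {vspace 'M[K]_n} -> Prop) (U : {vspace 'M[K]_n}) :
  (forall U', S U' -> {in U' &, forall x y, x *m y = y *m x}) ->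
  zariski_closure 3 L S U -> {in U &, forall x y, x *m y = y *m x}.
Proof.
move=> Scomm [UL dU closeU].
have [b bU] : exists b : 3.-tuple 'M[K]_n, basis_of U b.
  by rewrite -dU; exists (vbasis U); apply: vbasisP.
(* The three columns are the linear forms x |-> x_(i, c), x |-> x_(c, j) and l. Summing their wedge
   products over c gives l /\ (x, y |-> [x, y]_(i, j)). *)
pose M (i j : 'I_n) (l : 'cV[K]_(n * n)) (c : 'I_n) : 'M[K]_(n * n, 3) :=
  \matrix_(r, s) if s == 0 :> nat then (r == mxvec_index i c)%:R
            else if s == 1%N :> nat then (r == mxvec_index c j)%:R else l r 0.
have frameM (b' : 3.-tuple 'M[K]_n) i j l c (r s : 'I_3) :
    (frame_mx b' *m M i j l c) r s =
    if s == 0 :> nat then tnth b' r i c else if s == 1%N :> nat then tnth b' r c j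
    else (frame_mx b' *m l) r 0.
  rewrite !mxE; case: ifP => s0.
    rewrite (bigD1 (mxvec_index i c)) //= !mxE s0 eqxx mulr1 big1 ?addr0 //.
      by rewrite mxvecE.
    by move=> r' /negPf r'n; rewrite !mxE s0 r'n mulr0.
  case: ifP => s1.
    rewrite (bigD1 (mxvec_index c j)) //= !mxE s0 s1 eqxx mulr1 big1 ?addr0 //.
      by rewrite mxvecE.
    by move=> r' /negPf r'n; rewrite !mxE s0 s1 r'n mulr0.
  by apply: eq_bigr => r' _; rewrite !mxE s0 s1.
pose i0 : 'I_3 := @Ordinal 3 0 isT; pose i1 : 'I_3 := @Ordinal 3 1 isT.
pose i2 : 'I_3 := @Ordinal 3 2 isT.
have detM (b' : 3.-tuple 'M[K]_n) i j l :
    \sum_c \det (frame_mx b' *m M i j l c) =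
      let br r s := (tnth b' r *m tnth b' s - tnth b' s *m tnth b' r) i j in
      (frame_mx b' *m l) i0 0 * br i1 i2 + (frame_mx b' *m l) i1 0 * br i2 i0
      + (frame_mx b' *m l) i2 0 * br i0 i1.
  under eq_bigr => c _ do rewrite (@det_mx33 _ _ i0 i1 i2) // !frameM /=.
  have brE (r s : 'I_3) : (tnth b' r *m tnth b' s - tnth b' s *m tnth b' r) i j =
      \sum_c (tnth b' r i c * tnth b' s c j - tnth b' s i c * tnth b' r c j).
    by rewrite !mxE -sumrB.
  by rewrite /= !brE !big_distrr -!big_split /=; apply: eq_bigr => c _; ring.
have F_ex i j l : exists2 F : {mpoly K['C(n * n, 3)]}, F \is 1.-homog &
    forall b' : 3.-tuple 'M[K]_n,
      F.@[plucker (frame_mx b')] = \sum_c \det (frame_mx b' *m M i j l c).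
  have ex1 c : exists F : {mpoly K['C(n * n, 3)]}, F \is 1.-homog /\
      forall A, F.@[plucker A] = \det (A *m M i j l c).
    by have [F] := det_mulmx_pluecker (M i j l c); exists F.
  have [F FP] := fin_all_exists ex1; exists (\sum_c F c).
    by apply: rpred_sum => c _; have [] := FP c.
  move=> b'; rewrite raddf_sum /=; apply: eq_bigr => c _.
  by have [_ ->] := FP c.
have van i j l : \sum_c \det (frame_mx b *m M i j l c) = 0.
  have [F Fhom FE] := F_ex i j l; rewrite -FE.
  apply: (closeU _ F Fhom) bU => U' SU' b' b'U'; rewrite FE detM /=.
  have brE r s : tnth b' r *m tnth b' s - tnth b' s *m tnth b' r = 0.
    by apply/eqP; rewrite subr_eq0; apply/eqP/(Scomm _ SU'); apply: mem_basis_tnth.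
  by rewrite !brE !mxE !mulr0 !addr0.
(* The columns of [B] are linear forms dual to [b]; taking one of them for l leaves a single
   commutator in [detM]. *)
have [B bB] : exists B, frame_mx b *m B = 1%:M.
  by apply/row_freeP/row_free_frame/(basis_free bU).
have comm3 r s : tnth b r *m tnth b s = tnth b s *m tnth b r.
  have br (t : 'I_3) i j := van i j (col t B).
  have colB (t q : 'I_3) : (frame_mx b *m col t B) q 0 = (q == t)%:R.
    have <- : (frame_mx b *m B) q t = (q == t)%:R by rewrite bB mxE.
    by rewrite !mxE; apply: eq_bigr => r' _; rewrite !mxE.
  have c12 : tnth b i1 *m tnth b i2 - tnth b i2 *m tnth b i1 = 0.
    apply/matrixP => i j; have := br i0 i j; rewrite detM !colB /= mul1r !mul0r !addr0.
    by move=> ->; rewrite mxE.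
  have c20 : tnth b i2 *m tnth b i0 - tnth b i0 *m tnth b i2 = 0.
    apply/matrixP => i j; have := br i1 i j; rewrite detM !colB /= mul1r !mul0r addr0 add0r.
    by move=> ->; rewrite mxE.
  have c01 : tnth b i0 *m tnth b i1 - tnth b i1 *m tnth b i0 = 0.
    apply/matrixP => i j; have := br i2 i j; rewrite detM !colB /= mul1r !mul0r !add0r.
    by move=> ->; rewrite mxE.
  have case3 (q : 'I_3) : [\/ q = i0, q = i1 | q = i2].
    case: q => [[|[|[|//]]] q3]; [apply: Or31 | apply: Or32 | apply: Or33];
      exact: val_inj.
  move/eqP: c12; rewrite subr_eq0 => /eqP c12; move/eqP: c20; rewrite subr_eq0 => /eqP c20.
  move/eqP: c01; rewrite subr_eq0 => /eqP c01.
  by case: (case3 r) => ->; case: (case3 s) => ->.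
move=> x y; rewrite (basis_of_span bU) => /coord_span-> /coord_span->.
rewrite mulmx_suml [RHS]mulmx_sumr; apply: eq_bigr => i _.
rewrite mulmx_sumr mulmx_suml; apply: eq_bigr => j _.
by rewrite -!scalemxAl -!scalemxAr -!tnth_nth comm3 scalerA mulrC -scalerA.
Qed.

Lemma cartan_comm (K : fieldType) n (U : {vspace 'M[K]_n}) :
  cartan U -> {in U &, forall x y, x *m y = y *m x}.
Proof.
move=> [P uP UP] x y; rewrite !UP.
move=> /andP[_ /diag_mxP[dx Ex]] /andP[_ /diag_mxP[dy Ey]].
have conj z d : invmx P *m z *m P = d -> z = P *m d *m invmx P.
  by move<-; rewrite !mulmxA mulmxV // mul1mx mulmxK.
rewrite (conj _ _ Ex) (conj _ _ Ey) !mulmxA !mulmxKV //.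
by rewrite -![P *m _ *m _]mulmxA diag_mxC.
Qed.

Lemma Red_comm (K : fieldType) (U : {vspace 'M[K]_4}) :
  Red U -> {in U &, forall x y, x *m y = y *m x}.
Proof. by apply: zariski_closure_comm => U'; apply: cartan_comm. Qed.

(* A commutative quartic algebra with basis 1, x0, x1, x2 is given by
   xi * xj = d i j + \sum_k c i j k * xk. The skew form [omega c] on the 6 pairs (i, a) with i <= a,
   listed by [conic_pair], does not change when scalars are added to the xi. *)
Section QuarticAlgebras.
Variable K : numFieldType.
Implicit Types (c : nat -> nat -> nat -> K) (d : nat -> nat -> K) (W : nat -> nat -> K).

Definition conic_pair (u : nat) : nat * nat :=
  nth (0, 0)%N [:: (0, 0); (1, 1); (2, 2); (1, 2); (0, 2); (0, 1)]%N u.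

(** Inverse of [conic_pair] up to order: a mixed pair sits at 3 plus the missing index, which is 3 -
    (i + a). *)
Definition conic_index (i a : nat) : nat := if i == a then i else (6 - (i + a))%N.

Definition levi_civita (k a b : nat) : K :=
  match k, a, b with
  | 0, 1, 2 | 1, 2, 0 | 2, 0, 1 => 1%R
  | 0, 2, 1 | 2, 1, 0 | 1, 0, 2 => (-1)%R
  | _, _, _ => 0%R
  end%N.

Definition sum3 (f : nat -> K) : K := f 0%N + f 1%N + f 2%N.

(** The four terms choose one factor from each of the two monomials to be multiplied and put the
    other two into [levi_civita]. The factor 1/4 makes [omega] a left inverse of [struct_const] on
    skew forms. *)
Definition omega c (u v : nat) : K :=
  let: (i, a) := conic_pair u in let: (j, b) := conic_pair v in
  4%:R^-1 * sum3 (fun k =>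
    levi_civita k a b * c i j k + levi_civita k i b * c a j k +
    levi_civita k a j * c i b k + levi_civita k i j * c a b k).

(* Entry (l, k) of the commutator of multiplications by xi and xj. *)
Definition comm_defect c d (i j l k : nat) : K :=
  sum3 (fun m => c l i m * c m j k - c l j m * c m i k)
  + (if j == k then d l i else 0) - (if i == k then d l j else 0).

(** The Pfaffian of a 4 by 4 block of W. *)
Definition pluecker_rel W (u0 u1 u2 u3 : nat) : K :=
  W u0 u1 * W u2 u3 - W u0 u2 * W u1 u3 + W u0 u3 * W u1 u2.

Definition const_sym c := forall i j k, (i < 3)%N -> (j < 3)%N -> (k < 3)%N ->
  c i j k = c j i k.

Definition scalar_sym d := forall i j, (i < 3)%N -> (j < 3)%N -> d i j = d j i.

Definition const_comm c d := forall i j l k,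
  (i < 3)%N -> (j < 3)%N -> (l < 3)%N -> (k < 3)%N -> comm_defect c d i j l k = 0.

(** Packed as one tuple of equations, to be used as a single multirule that sorts the lower indices
    before [ring]. *)
Lemma const_symE c : const_sym c ->
  (((c 1%N 0%N 0%N = c 0%N 1%N 0%N) * (c 1%N 0%N 1%N = c 0%N 1%N 1%N) *
    (c 1%N 0%N 2%N = c 0%N 1%N 2%N)) *
   ((c 2%N 0%N 0%N = c 0%N 2%N 0%N) * (c 2%N 0%N 1%N = c 0%N 2%N 1%N) *
    (c 2%N 0%N 2%N = c 0%N 2%N 2%N)) *
   ((c 2%N 1%N 0%N = c 1%N 2%N 0%N) * (c 2%N 1%N 1%N = c 1%N 2%N 1%N) *
    (c 2%N 1%N 2%N = c 1%N 2%N 2%N)))%type.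
Proof. by move=> csym; do !split; apply: csym. Qed.

Lemma scalar_symE d : scalar_sym d ->
  ((d 1%N 0%N = d 0%N 1%N) * (d 2%N 0%N = d 0%N 2%N) * (d 2%N 1%N = d 1%N 2%N))%type.
Proof. by move=> dsym; do !split; apply: dsym. Qed.

Lemma omega_skew c u v : (u < 6)%N -> (v < 6)%N ->
  const_sym c -> omega c u v = - omega c v u.
Proof.
move=> u6 v6 /const_symE csym.
rewrite /omega /conic_pair /sum3.
case: u u6 => [|[|[|[|[|[|//]]]]]] _; case: v v6 => [|[|[|[|[|[|//]]]]]] _;
  rewrite /= ?csym; ring.
Qed.

Lemma omega_pluecker_lt c d u0 u1 u2 u3 :
  (u0 < u1 < u2)%N -> (u2 < u3 < 6)%N ->
  const_sym c -> scalar_sym d -> const_comm c d ->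
  pluecker_rel (omega c) u0 u1 u2 u3 = 0.
Proof.
move=> /andP[u01 u12] /andP[u23 u36] /const_symE csym /scalar_symE dsym defect0.
(* Each relation is quadratic in [omega]; the factor 16 clears its denominators 4 and leaves
   identities with integer coefficients. *)
suff : 16%:R * pluecker_rel (omega c) u0 u1 u2 u3 = 0.
  by move/eqP; rewrite mulf_eq0 Num.Theory.pnatr_eq0 => /eqP.
pose w u v := 4%:R * omega c u v.
have -> : 16%:R * pluecker_rel (omega c) u0 u1 u2 u3 = pluecker_rel w u0 u1 u2 u3.
  by rewrite /pluecker_rel /w; ring.
pose ww u v := let: (i, a) := conic_pair u in let: (j, b) := conic_pair v in
  sum3 (fun k =>
    levi_civita k a b * c i j k + levi_civita k i b * c a j k +
    levi_civita k a j * c i b k + levi_civita k i j * c a b k).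
have wE u v : w u v = ww u v.
  rewrite /w /ww /omega; case: (conic_pair u) => i a; case: (conic_pair v) => j b.
  by rewrite mulVKf // Num.Theory.pnatr_eq0.
have {wE} -> : pluecker_rel w u0 u1 u2 u3 = pluecker_rel ww u0 u1 u2 u3.
  by rewrite /pluecker_rel !wE.
have red (r x : K) : r = 0 -> x = r -> x = 0 by move=> -> ->.
(* The multipliers solve the linear system that expresses each Pluecker relation as a combination
   of entries of commutators. *)
have rel0123 : pluecker_rel ww 0 1 2 3 = 0.
  apply: (red (8%:R * comm_defect c d 0 1 2 0 - 8%:R * comm_defect c d 0 2 1 0));
    first by rewrite !defect0 //; ring.
  by rewrite /comm_defect /pluecker_rel /ww /sum3 /= !csym ?dsym; ring.
have rel0124 : pluecker_rel ww 0 1 2 4 = 0.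
  apply: (red (8%:R * comm_defect c d 0 2 1 1));
    first by rewrite !defect0 //; ring.
  by rewrite /comm_defect /pluecker_rel /ww /sum3 /= !csym ?dsym; ring.
have rel0125 : pluecker_rel ww 0 1 2 5 = 0.
  apply: (red (8%:R * comm_defect c d 0 1 0 0 + 8%:R * comm_defect c d 0 1 1 1));
    first by rewrite !defect0 //; ring.
  by rewrite /comm_defect /pluecker_rel /ww /sum3 /= !csym ?dsym; ring.
have rel0134 : pluecker_rel ww 0 1 3 4 = 0.
  apply: (red (-4%:R * comm_defect c d 0 1 0 0 - 4%:R * comm_defect c d 0 2 1 2));
    first by rewrite !defect0 //; ring.
  by rewrite /comm_defect /pluecker_rel /ww /sum3 /= !csym ?dsym; ring.
have rel0135 : pluecker_rel ww 0 1 3 5 = 0.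
  apply: (red (-4%:R * comm_defect c d 0 1 1 2));
    first by rewrite !defect0 //; ring.
  by rewrite /comm_defect /pluecker_rel /ww /sum3 /= !csym ?dsym; ring.
have rel0145 : pluecker_rel ww 0 1 4 5 = 0.
  apply: (red (-4%:R * comm_defect c d 0 1 0 2));
    first by rewrite !defect0 //; ring.
  by rewrite /comm_defect /pluecker_rel /ww /sum3 /= !csym ?dsym; ring.
have rel0234 : pluecker_rel ww 0 2 3 4 = 0.
  apply: (red (-4%:R * comm_defect c d 0 2 2 1));
    first by rewrite !defect0 //; ring.
  by rewrite /comm_defect /pluecker_rel /ww /sum3 /= !csym ?dsym; ring.
have rel0235 : pluecker_rel ww 0 2 3 5 = 0.
  apply: (red (-4%:R * comm_defect c d 0 1 2 1 - 4%:R * comm_defect c d 0 2 0 0));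
    first by rewrite !defect0 //; ring.
  by rewrite /comm_defect /pluecker_rel /ww /sum3 /= !csym ?dsym; ring.
have rel0245 : pluecker_rel ww 0 2 4 5 = 0.
  apply: (red (4%:R * comm_defect c d 0 2 0 1));
    first by rewrite !defect0 //; ring.
  by rewrite /comm_defect /pluecker_rel /ww /sum3 /= !csym ?dsym; ring.
have rel0345 : pluecker_rel ww 0 3 4 5 = 0.
  apply: (red (2%:R * comm_defect c d 0 1 0 1 - 2%:R * comm_defect c d 0 2 0 2));
    first by rewrite !defect0 //; ring.
  by rewrite /comm_defect /pluecker_rel /ww /sum3 /= !csym ?dsym; ring.
have rel1234 : pluecker_rel ww 1 2 3 4 = 0.
  apply: (red (4%:R * comm_defect c d 1 2 2 0));
    first by rewrite !defect0 //; ring.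
  by rewrite /comm_defect /pluecker_rel /ww /sum3 /= !csym ?dsym; ring.
have rel1235 : pluecker_rel ww 1 2 3 5 = 0.
  apply: (red (4%:R * comm_defect c d 1 2 1 0));
    first by rewrite !defect0 //; ring.
  by rewrite /comm_defect /pluecker_rel /ww /sum3 /= !csym ?dsym; ring.
have rel1245 : pluecker_rel ww 1 2 4 5 = 0.
  apply: (red (4%:R * comm_defect c d 0 1 2 0 - 4%:R * comm_defect c d 1 2 1 1));
    first by rewrite !defect0 //; ring.
  by rewrite /comm_defect /pluecker_rel /ww /sum3 /= !csym ?dsym; ring.
have rel1345 : pluecker_rel ww 1 3 4 5 = 0.
  apply: (red (2%:R * comm_defect c d 0 1 1 0 + 2%:R * comm_defect c d 1 2 1 2));
    first by rewrite !defect0 //; ring.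
  by rewrite /comm_defect /pluecker_rel /ww /sum3 /= !csym ?dsym; ring.
have rel2345 : pluecker_rel ww 2 3 4 5 = 0.
  apply: (red (-2%:R * comm_defect c d 0 2 2 0 + 2%:R * comm_defect c d 1 2 2 1));
    first by rewrite !defect0 //; ring.
  by rewrite /comm_defect /pluecker_rel /ww /sum3 /= !csym ?dsym; ring.
move: u01 u12 u23 u36; clear -rel0123 rel0124 rel0125 rel0134 rel0135 rel0145 rel0234
  rel0235 rel0245 rel0345 rel1234 rel1235 rel1245 rel1345 rel2345.
case: u3 => [|[|[|[|[|[|u3]]]]]]; case: u2 => [|[|[|[|[|u2]]]]] //;
  case: u1 => [|[|[|[|u1]]]] //; case: u0 => [|[|[|u0]]] //.
Qed.

End QuarticAlgebras.

(** * Decomposable skew forms *)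

Section SkewForms.
Variable K : numFieldType.
Implicit Types (W : nat -> nat -> K).

Definition skew_form n W := forall u v, (u < n)%N -> (v < n)%N -> W u v = - W v u.

Lemma skew_form_diag n W u : skew_form n W -> (u < n)%N -> W u u = 0.
Proof.
move=> Wskew un; have /eqP := Wskew u u un un.
by rewrite -addr_eq0 -mulr2n Num.Theory.mulrn_eq0 => /eqP.
Qed.

(** The Pfaffian is alternating: adjacent transpositions change its sign, and a repeated index makes
    it vanish. *)
Lemma pluecker_rel_sort n W : skew_form n W ->
  (forall u0 u1 u2 u3, (u0 < u1 < u2)%N -> (u2 < u3 < n)%N ->
     pluecker_rel W u0 u1 u2 u3 = 0) ->
  forall u0 u1 u2 u3, (u0 < n)%N -> (u1 < n)%N -> (u2 < n)%N -> (u3 < n)%N ->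
    pluecker_rel W u0 u1 u2 u3 = 0.
Proof.
move=> Wskew lt_rel; have W0 := skew_form_diag Wskew.
have swap01 a b c d : (a < n)%N -> (b < n)%N ->
    pluecker_rel W b a c d = 0 -> pluecker_rel W a b c d = 0.
  move=> an bn E; rewrite -[RHS]oppr0 -E /pluecker_rel (Wskew b a) //; ring.
have swap12 a b c d : (b < n)%N -> (c < n)%N ->
    pluecker_rel W a c b d = 0 -> pluecker_rel W a b c d = 0.
  move=> bn cn E; rewrite -[RHS]oppr0 -E /pluecker_rel (Wskew c b) //; ring.
have swap23 a b c d : (c < n)%N -> (d < n)%N ->
    pluecker_rel W a b d c = 0 -> pluecker_rel W a b c d = 0.
  move=> cn dn E; rewrite -[RHS]oppr0 -E /pluecker_rel (Wskew d c) //; ring.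
have step3 a b c d : (a < b < c)%N -> (c < n)%N -> (d < n)%N ->
    pluecker_rel W a b c d = 0.
  move=> /andP[ab bc] cn dn; have bn := ltn_trans bc cn; have an := ltn_trans ab bn.
  have [cd | dc | <-] := ltngtP c d; first by apply: lt_rel; rewrite ?ab ?cd.
    apply: swap23 => //; have [bd | db | <-] := ltngtP b d.
    - by apply: lt_rel; rewrite ?ab ?dc.
    - apply: swap12 => //; have [ad | da | <-] := ltngtP a d.
      + by apply: lt_rel; rewrite ?ad ?bc.
      + by apply: swap01 => //; apply: lt_rel; rewrite ?da ?bc.
      by rewrite /pluecker_rel W0 //; ring.
    by rewrite /pluecker_rel W0 //; ring.
  by rewrite /pluecker_rel W0 //; ring.
have step2 a b c d : (a < b)%N -> (b < n)%N -> (c < n)%N -> (d < n)%N ->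
    pluecker_rel W a b c d = 0.
  move=> ab bn cn dn; have an := ltn_trans ab bn.
  have [bc | cb | <-] := ltngtP b c; first by apply: step3; rewrite ?ab.
    apply: swap12 => //; have [ac | ca | <-] := ltngtP a c.
    - by apply: step3; rewrite ?ac.
    - by apply: swap01 => //; apply: step3; rewrite ?ca.
    by rewrite /pluecker_rel W0 //; ring.
  by rewrite /pluecker_rel W0 //; ring.
move=> a b c d an bn cn dn; have [ab | ba | <-] := ltngtP a b; first exact: step2.
  by apply: swap01 => //; apply: step2.
by rewrite /pluecker_rel W0 //; ring.
Qed.

Variable n : nat.

Definition wedge_row W : 'rV[K]_('C(n, 2)) :=
  \row_i W (tnth (pluecker_tuple i) ord0) (tnth (pluecker_tuple i) ord_max).

Lemma pluecker2E (A : 'M[K]_(2, n)) i :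
  let: (u, v) := (tnth (pluecker_tuple i) ord0, tnth (pluecker_tuple i) ord_max) in
  plucker A i = A ord0 u * A ord_max v - A ord0 v * A ord_max u.
Proof. by rewrite /plucker det_mx22 !mxE. Qed.

(** If W p q is nonzero, the relation at p, q, u, v exhibits W as the wedge of its rows p and q
    divided by W p q. *)
Lemma skew_form_cone W : (2 <= n)%N -> skew_form n W ->
  (forall u0 u1 u2 u3, (u0 < n)%N -> (u1 < n)%N -> (u2 < n)%N -> (u3 < n)%N ->
     pluecker_rel W u0 u1 u2 u3 = 0) ->
  grassmannian_cone (wedge_row W).
Proof.
move=> n2 Wskew Wrel.
have [W0 | ] := boolP [forall u : 'I_n, forall v : 'I_n, W u v == 0].
  (* The vertex of the cone is reached with scalar 0, whatever the matrix of rank 2. *)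
  exists (pid_mx 2), 0; rewrite rank_pid_mx //; split=> //.
  rewrite scale0r; apply/rowP => i; rewrite !mxE; apply/eqP.
  by have /forallP/(_ (tnth (pluecker_tuple i) ord0))/forallP := W0; apply.
rewrite negb_forall => /existsP[p]; rewrite negb_forall => /existsP[q Wpq].
pose A : 'M[K]_(2, n) := \matrix_(r, s) if r == ord0 then W p s else W q s.
have W0 u := skew_form_diag Wskew (ltn_ord u).
exists A, (W p q)^-1; split.
  apply/eqP; rewrite -[_ == _]/(row_free A); apply/row_freeP.
  pose f (j : 'I_2) := if j == ord0 then p else q.
  have dA : colsub f A \in unitmx.
    rewrite unitmxE unitfE det_mx22 !mxE /= !W0 (Wskew q p) // mul0r sub0r.
    by rewrite mulrN opprK mulf_neq0.
  exists (colsub f 1%:M *m invmx (colsub f A)).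
  by rewrite mulmxA mulmx_colsub mulmx1 mulmxV.
apply/rowP => i; rewrite [LHS]mxE [RHS]mxE [X in _ = _ * X]mxE pluecker2E !mxE /=.
set u := tnth _ _; set v := tnth _ _.
apply: (mulfI Wpq); rewrite mulVKf //.
have /eqP := Wrel p q u v (ltn_ord p) (ltn_ord q) (ltn_ord u) (ltn_ord v).
rewrite /pluecker_rel => /eqP E; apply/eqP; rewrite -subr_eq0 -E; apply/eqP; ring.
Qed.

End SkewForms.

(** * The quartic algebra of a skew form *)

Section StructureConstants.
Variable K : numFieldType.
Implicit Types (c : nat -> nat -> nat -> K) (d : nat -> nat -> K) (W : nat -> nat -> K).

Lemma omega_cone c d :
  const_sym c -> scalar_sym d -> const_comm c d ->
  grassmannian_cone (wedge_row 6 (omega c)).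
Proof.
move=> csym dsym defect0.
have skew : skew_form 6 (omega c) by move=> u v u6 v6; apply: omega_skew.
apply: skew_form_cone => //; apply: pluecker_rel_sort => // u0 u1 u2 u3 u012 u236.
exact: omega_pluecker_lt defect0.
Qed.

(** Successor modulo 3; the default value 0 of [nth] serves as the successor of 2. *)
Definition next3 (k : nat) : nat := nth 0%N [:: 1; 2]%N k.

(** Among the constants with a given form this representative modulo translations has zero traces,
    so that the xi become traceless. *)
Definition struct_const W (i j k : nat) : K :=
  W (conic_index i (next3 k)) (conic_index j (next3 (next3 k)))
  - W (conic_index i (next3 (next3 k))) (conic_index j (next3 k)).

(** Forced by traces. As the xk are traceless, tr (xi xj) = 4 d i j; computed from the matrices it
    is 2 d i j plus the double sum, whence the factor 1/2. *)
Definition struct_const0 W (i j : nat) : K :=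
  2%:R^-1 * sum3 (fun l => sum3 (fun m => struct_const W i l m * struct_const W j m l)).

Lemma omega_struct_const W u v : skew_form 6 W -> (u < 6)%N -> (v < 6)%N ->
  omega (struct_const W) u v = W u v.
Proof.
move=> Wskew u6 v6; have W0 u' := skew_form_diag (u := u') Wskew.
apply: (mulfI (_ : 4%:R != 0)); first by rewrite Num.Theory.pnatr_eq0.
rewrite /omega /conic_pair /struct_const /sum3.
case: u u6 => [|[|[|[|[|[|//]]]]]] _; case: v v6 => [|[|[|[|[|[|//]]]]]] _;
  rewrite /= mulVKf ?Num.Theory.pnatr_eq0 // /conic_index /= ?W0 //
  ?(Wskew 1 0)%N ?(Wskew 2 0)%N ?(Wskew 3 0)%N ?(Wskew 4 0)%N ?(Wskew 5 0)%N
  ?(Wskew 2 1)%N ?(Wskew 3 1)%N ?(Wskew 4 1)%N ?(Wskew 5 1)%N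
  ?(Wskew 3 2)%N ?(Wskew 4 2)%N ?(Wskew 5 2)%N
  ?(Wskew 4 3)%N ?(Wskew 5 3)%N ?(Wskew 5 4)%N //; ring.
Qed.

(** Multiplication by xj acting on row vectors in the basis 1, x0, x1, x2; row 0 says that 1 is sent
    to xj. *)
Definition alg_mx c d (j : nat) : 'M[K]_4 :=
  \matrix_(r, s)
    match r : nat, s : nat with
    | 0, s => (s == j.+1)%:R
    | r.+1, 0 => d r j
    | r.+1, s.+1 => c r j s
    end.

Definition quartic_mx W := alg_mx (struct_const W) (struct_const0 W).

Lemma trace_quartic_mx W j : skew_form 6 W -> (j < 3)%N -> \tr (quartic_mx W j) = 0.
Proof.
move=> Wskew j3; have W0 u' := skew_form_diag (u := u') Wskew.
rewrite /mxtrace !big_ord_recl big_ord0 !mxE /= /struct_const.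
case: j j3 => [|[|[|//]]] _; rewrite /= /conic_index /= ?W0 //;
  rewrite ?(Wskew 3 1)%N ?(Wskew 3 2)%N ?(Wskew 5 4)%N ?(Wskew 4 0)%N ?(Wskew 5 3)%N
    ?(Wskew 5 0)%N ?(Wskew 4 2)%N ?(Wskew 4 3)%N ?(Wskew 5 1)%N //; ring.
Qed.

Lemma struct_const_sym W : skew_form 6 W -> const_sym (struct_const W).
Proof.
move=> Wskew i j k; have idx : forall a b, (a < 3)%N -> (b < 3)%N -> (conic_index a b < 6)%N.
  by move=> [|[|[|//]]] [|[|[|//]]].
have nx a : (next3 a < 3)%N by case: a => [|[|[|a]]].
move=> i3 j3 k3; rewrite /struct_const (Wskew (conic_index j _)) ?idx ?nx //.
by rewrite (Wskew (conic_index j (next3 (next3 k)))) ?idx ?nx //; ring.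
Qed.

Lemma struct_const0_sym W : scalar_sym (struct_const0 W).
Proof. by move=> i j _ _; rewrite /struct_const0 /sum3; ring. Qed.

(** Once W is written as a /\ b, the Pluecker relations hold identically, and so each commutator
    entry vanishes as a polynomial in a and b. Doubling removes the denominator of
    [struct_const0]. *)
Lemma struct_const_comm (a b : nat -> K) :
  let W u v := a u * b v - a v * b u in
  const_comm (struct_const W) (struct_const0 W).
Proof.
move=> W i j l k i3 j3 l3 k3.
apply: (mulfI (_ : 2%:R != 0)); first by rewrite Num.Theory.pnatr_eq0.
pose d' i j := sum3 (fun l => sum3 (fun m => struct_const W i l m * struct_const W j m l)).
have dE i' j' : 2%:R * struct_const0 W i' j' = d' i' j'.
  by rewrite /struct_const0 mulVKf // Num.Theory.pnatr_eq0.
rewrite /comm_defect mulr0 mulrBr mulrDr ![2%:R * (if _ then _ else _)]fun_if !mulr0 !dE.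
move: i3 j3 l3 k3; rewrite /d' /sum3 /struct_const /W.
case: i => [|[|[|//]]]; case: j => [|[|[|//]]];
  case: l => [|[|[|//]]]; case: k => [|[|[|//]]] _ _ _ _;
  rewrite /conic_index /=; ring.
Qed.

(* The Jacobi identity for the traceless parts of the multiplications gives
   the associativity of the scalar parts. *)
Lemma scalar_const_comm c d i j l : const_sym c -> scalar_sym d -> const_comm c d ->
  (i < 3)%N -> (j < 3)%N -> (l < 3)%N ->
  sum3 (fun m => c l i m * d m j) = sum3 (fun m => c l j m * d m i).
Proof.
move=> /const_symE csym /scalar_symE dsym H.
(* The commutator of the linear part of xr with the vanishing defect of xp and xq. In the cyclic sum
   the triple commutators of linear parts cancel by Jacobi, and only terms with d remain. *)
pose D p q r l' t := sum3 (fun m =>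
  c l' r m * comm_defect c d p q m t - comm_defect c d p q l' m * c m r t).
have D0 p q r l' t : (p < 3)%N -> (q < 3)%N -> (r < 3)%N -> (l' < 3)%N -> (t < 3)%N ->
    D p q r l' t = 0.
  by move=> *; rewrite /D /sum3 !H //; ring.
have red (x y r : K) : r = 0 -> x = y + r -> x = y by move=> -> ->; rewrite addr0.
have red' l' t : (l' < 3)%N -> (t < 3)%N ->
    D 0%N 1%N 2%N l' t + D 1%N 2%N 0%N l' t + D 2%N 0%N 1%N l' t = 0.
  by move=> l3 t3; rewrite !D0 // !addr0.
have redN l' t : (l' < 3)%N -> (t < 3)%N ->
    - (D 0%N 1%N 2%N l' t + D 1%N 2%N 0%N l' t + D 2%N 0%N 1%N l' t) = 0.
  by move=> l3 t3; rewrite red' // oppr0.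
wlog ij : i j / (i < j)%N => [wlt|].
  by have [ij | ji | ->] := ltngtP i j => // *; [apply: wlt | symmetry; apply: wlt].
(* The index different from i and j: in column t the remaining terms are the difference of the two
   sides, up to sign. *)
move=> i3 j3 l3; pose t := (3 - (i + j))%N; have t3 : (t < 3)%N.
  by rewrite /t ltn_subrL (leq_trans _ (leq_addl i j)) // (leq_ltn_trans _ ij).
have jacobi := red' l t l3 t3; have jacobiN := redN l t l3 t3.
move: ij i3 j3 l3 jacobi jacobiN {t3}; rewrite {}/t.
case: l => [|[|[|//]]]; case: i => [|[|//]]; case: j => [|[|[|//]]] // _ _ _ _ E EN;
  (* The sign depends on whether (t, i, j) is a cyclic rotation of (0, 1, 2). *)
  first [ apply: (red _ _ _ E); rewrite /D /comm_defect /sum3 /= !csym ?dsym; ring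
        | apply: (red _ _ _ EN); rewrite /D /comm_defect /sum3 subnE /= !csym ?dsym; ring].
Qed.

Lemma alg_mx_comm c d i j : const_sym c -> scalar_sym d -> const_comm c d ->
  (i < 3)%N -> (j < 3)%N ->
  alg_mx c d i *m alg_mx c d j = alg_mx c d j *m alg_mx c d i.
Proof.
move=> csym dsym H i3 j3.
have sum4 (f : 'I_4 -> K) : \sum_s f s = f ord0 + sum3 (fun m => f (inord m.+1)).
  rewrite !big_ord_recl big_ord0 addr0 /sum3 !addrA.
  by congr (_ + _ + _ + _); congr f; apply: val_inj; rewrite /= inordK.
have val_inord m : (m < 3)%N -> nat_of_ord (inord m.+1 : 'I_4) = m.+1.
  by move=> m3; rewrite inordK.
have entry i' j' r s : (i' < 3)%N -> (j' < 3)%N -> (alg_mx c d i' *m alg_mx c d j') r s =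
    match r : nat, s : nat with
    | 0, 0 => d i' j'
    | 0, s.+1 => c i' j' s
    | r.+1, 0 => sum3 (fun m => c r i' m * d m j')
    | r.+1, s.+1 => (if s == j' then d r i' else 0) + sum3 (fun m => c r i' m * c m j' s)
    end.
  move=> i3' j3'; rewrite mxE sum4 /sum3 !mxE !val_inord //.
  case: r s => [[|r] r4] [[|s] s4] /=; rewrite ?mul0r ?mulr0 ?add0r //.
  - by case: i' i3' => [|[|[|//]]] _; rewrite /= ?mul1r ?mul0r ?add0r ?addr0.
  - by case: i' i3' => [|[|[|//]]] _; rewrite /= ?mul1r ?mul0r ?add0r ?addr0.
  by rewrite eqSS; case: eqP; rewrite ?mulr1 ?mulr0.
apply/matrixP => r s; rewrite !entry //; case: r s => [[|r] r4] [[|s] s4] /=.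
- exact: dsym.
- exact: csym.
- exact: scalar_const_comm.
apply/eqP; rewrite -subr_eq0; apply/eqP; rewrite -[RHS](H i j r s) //.
rewrite /comm_defect [s == j]eq_sym [s == i]eq_sym /sum3; ring.
Qed.

Lemma quartic_mx_comm (a b : nat -> K) i j : (i < 3)%N -> (j < 3)%N ->
  let W u v := a u * b v - a v * b u in
  quartic_mx W i *m quartic_mx W j = quartic_mx W j *m quartic_mx W i.
Proof.
move=> i3 j3 W; apply: alg_mx_comm => //.
- by apply: struct_const_sym => u v _ _; rewrite /W; ring.
- exact: struct_const0_sym.
exact: struct_const_comm.
Qed.

End StructureConstants.

(** * Cartan subalgebras and their limits along polynomial families *)

Section CartanCriterion.
Variable K : numClosedFieldType.

Lemma separable_diagonalizable n (X : 'M[K]_n.+1) :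
  separable_poly (char_poly X) ->
  exists2 P : 'M[K]_n.+1, P \in unitmx & exists2 d : 'rV[K]_n.+1,
    P *m X = diag_mx d *m P & injective (d 0).
Proof.
move=> sepX; have [rs Ers] := closed_field_poly_normal (char_poly X).
rewrite (monicP (char_poly_monic X)) scale1r in Ers.
have urs : uniq rs by rewrite -separable_prod_XsubC -Ers.
have /diagonalizableP[P uP /diagonalizable_forPex[d /simmxP]] :
    exists2 rs, uniq rs & mxminpoly X %| \prod_(x <- rs) ('X - x%:P).
  by exists rs => //; rewrite -Ers mxminpoly_dvd_char.
move=> /(_ uP) PX; exists P => //; exists d => //.
have charD : char_poly X = \prod_(i < n.+1) ('X - (d 0 i)%:P).
  have -> : X = invmx P *m diag_mx d *m P by rewrite -mulmxA -PX mulKmx.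
  transitivity (char_poly (diag_mx d)).
    rewrite /char_poly /char_poly_mx !map_mxM /=.
    have XE : ('X%:M : 'M[{poly K}]_n.+1) =
        map_mx polyC (invmx P) *m 'X%:M *m map_mx polyC P.
      by rewrite scalar_mxC -mulmxA -map_mxM mulVmx // map_mx1 mulmx1.
    rewrite [in LHS]XE -mulmxBl -mulmxBr !det_mulmx mulrAC -det_mulmx -map_mxM mulVmx //.
    by rewrite map_mx1 det1 mul1r.
  rewrite char_poly_trig; last by rewrite diag_mx_is_trig.
  by apply: eq_bigr => i _; rewrite mxE eqxx.
have : uniq [seq d 0 i | i <- enum 'I_n.+1].
  by rewrite -separable_prod_XsubC big_map big_enum -charD.
by rewrite -[enum _]/(enum 'I_n.+1) => /injectiveP.
Qed.

Lemma comm_diag_distinct n (d : 'rV[K]_n) (Y : 'M[K]_n) : injective (d 0) ->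
  Y *m diag_mx d = diag_mx d *m Y -> is_diag_mx Y.
Proof.
move=> d_inj YD; apply/is_diag_mxP => i j ij.
have /matrixP/(_ i j) := YD; rewrite mul_mx_diag mul_diag_mx !mxE => /eqP.
rewrite mulrC -subr_eq0 -mulrBl mulf_eq0 subr_eq0 => /orP[/eqP/d_inj E|/eqP//].
by rewrite E eqxx in ij.
Qed.

(** The centralizer of X consists of the matrices diagonal in its eigenbasis. Its traceless part has
    dimension at most n, so U fills it. *)
Lemma cartan_criterion n (U : {vspace 'M[K]_n.+1}) (X : 'M[K]_n.+1) :
  (U <= sl K n.+1)%VS -> \dim U = n -> separable_poly (char_poly X) ->
  (forall Y, Y \in U -> Y *m X = X *m Y) -> cartan U.
Proof.
move=> Usl dU /separable_diagonalizable[P uP [d PX d_inj]] UX.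
have uP' : invmx P \in unitmx by rewrite unitmx_inv.
pose f (v : 'rV[K]_n.+1) : 'M[K]_n.+1 := invmx P *m diag_mx v *m P.
have f_lin : linear f.
  by move=> c u v; rewrite /f linearP /= mulmxDr mulmxDl -scalemxAr -scalemxAl.
pose fL := GRing.isLinear.Build _ _ _ _ f f_lin.
pose F : {linear 'rV[K]_n.+1 -> 'M[K]_n.+1} := HB.pack f fL.
pose D := limg (linfun F); pose C := (sl K n.+1 :&: D)%VS.
have memD Y : is_diag_mx (P *m Y *m invmx P) = (Y \in D).
  apply/idP/idP => [/diag_mxP[v Ev] | /memv_imgP[v _ ->]].
    apply/memv_imgP; exists v; rewrite ?memvf // lfunE /= /f -Ev.
    by rewrite !mulmxA mulVmx // mul1mx mulmxKV.
  by rewrite lfunE /= /f !mulmxA mulmxV // mul1mx mulmxK.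
(* The identity is diagonal but not traceless, so [C] is a proper subspace of [D], which has
   dimension at most n + 1. *)
have dC : (\dim C <= n)%N.
  rewrite -ltnS; apply: (@leq_trans (\dim D)).
    have CD : (C <= D)%VS by rewrite capvSr.
    rewrite ltn_neqAle dimvS // andbT; apply/eqP => dCD.
    have /eqP E : C == D by rewrite eqEdim CD dCD leqnn.
    have : 1%:M \in C.
      by rewrite E -memD mulmx1 mulmxV // scalar_mx_is_diag.
    rewrite memv_cap mem_sl mxtrace1 => /andP[/eqP n0 _].
    by have := Num.Theory.pnatr_eq0 K n.+1; rewrite n0 eqxx.
  have := limg_ker_dim (linfun F) fullv.
  by rewrite dimvf /dim /= mul1n => dimE; rewrite -[leqRHS]dimE leq_addl.
have UC : (U <= C)%VS.
  rewrite subv_cap Usl /=; apply/subvP => Y /UX YX; rewrite -memD.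
  apply: comm_diag_distinct d_inj _.
  have -> : diag_mx d = P *m X *m invmx P by rewrite PX mulmxK.
  by rewrite !mulmxA !mulmxKV // -[P *m Y *m X]mulmxA YX mulmxA.
have EU : U = C by apply/eqP; rewrite eqEdim UC dU.
by exists (invmx P) => // Y; rewrite invmxK memD -memv_cap EU.
Qed.

Lemma separable_eigen n (X : 'M[K]_n) (a : 'I_n -> K) (v : 'I_n -> 'rV[K]_n) :
  injective a -> (forall i, v i != 0) -> (forall i, v i *m X = a i *: v i) ->
  separable_poly (char_poly X).
Proof.
move=> a_inj v0 vX.
have roots i : root (char_poly X) (a i).
  by rewrite -eigenvalue_root_char; apply/eigenvalueP; exists (v i).
have := @all_roots_prod_XsubC _ (char_poly X) [seq a i | i <- enum 'I_n].
rewrite size_char_poly size_map -cardE card_ord => ->//; last 2 first.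
- by rewrite all_map; apply/allP => i _ /=.
- by rewrite uniq_rootsE map_inj_uniq ?enum_uniq.
rewrite (monicP (char_poly_monic X)) scale1r separable_prod_XsubC.
by rewrite map_inj_uniq ?enum_uniq.
Qed.

(* The discriminant of the characteristic polynomial of [X t] is a nonzero polynomial in t. *)
Lemma Red_line n (B : K -> n.-tuple 'M[K]_n.+1) (X : K -> 'M[K]_n.+1) t0 :
  (forall i r s, polyfun (fun t => tnth (B t) i r s)) ->
  (forall r s, polyfun (fun t => X t r s)) ->
  (forall t, free (B t)) -> (forall t i, \tr (tnth (B t) i) = 0) ->
  (forall t i, tnth (B t) i *m X t = X t *m tnth (B t) i) ->
  separable_poly (char_poly (X t0)) ->
  forall t, Red <<B t>>%VS.
Proof.
move=> polyB polyX freeB trB commB sep0.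
have alg := polyfun_subalgebra K.
have Bsl t : (<<B t>> <= sl K n.+1)%VS.
  by apply/span_subvP => _ /tnthP[i ->]; rewrite mem_sl trB.
have dimB t : \dim <<B t>> = n by have /eqP-> := freeB t; rewrite size_tuple.
have [M ME] : exists M : 'M[{poly K}]_n.+1, forall t, map_mx (horner_eval t) M = X t.
  have /fin_all_exists[M0 M0P] :
      forall rs : 'I_n.+1 * 'I_n.+1, exists p, forall t, X t rs.1 rs.2 = p.[t].
    by move=> [r s]; apply: polyX.
  exists (\matrix_(r, s) M0 (r, s)) => t; apply/matrixP => r s.
  by rewrite !mxE (M0P (r, s)).
pose p := char_poly M; pose disc t := (resultant p p^`()).[t].
have mapp t : map_poly (horner_eval t) p = char_poly (X t).
  by rewrite /p map_char_poly ME.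
have szp : size p = n.+2 by rewrite size_char_poly.
have lead_p : p`_n.+1 = 1.
  by rewrite -[RHS](monicP (char_poly_monic M)) lead_coefE -/p szp.
(* Resultants commute with specialization at t when leading coefficients do not vanish there; those
   of p and p' are the constants 1 and n + 1. *)
have lead_p' : lead_coef p^`() = n.+1%:R.
  have szp' : size p^`() = n.+1.
    apply/eqP; rewrite eqn_leq; apply/andP; split.
      by rewrite -ltnS -szp lt_size_deriv // -size_poly_gt0 szp.
    rewrite ltnNge; apply/negP => /leq_sizeP/(_ n (leqnn n)).
    rewrite coef_deriv lead_p => /eqP.
    by rewrite -polyC1 -polyCMn polyC_eq0 Num.Theory.pnatr_eq0.
  by rewrite lead_coefE szp' coef_deriv lead_p.
have discE t : disc t = resultant (char_poly (X t)) (char_poly (X t))^`().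
  rewrite /disc -[_.[t]]/(horner_eval t _) map_resultant.
  - by rewrite -deriv_map mapp.
  - by rewrite (monicP (char_poly_monic M)) rmorph1 oner_eq0.
  by rewrite lead_p' rmorph_nat Num.Theory.pnatr_eq0.
have disc_sep t : (disc t != 0) = separable_poly (char_poly (X t)).
  rewrite discE resultant_eq0 -leqNgt unlock /coprimep eqn_leq andbC.
  rewrite size_poly_gt0 gcdp_eq0 negb_and -size_poly_gt0 size_char_poly //=.
have poly_disc : polyfun disc by exists (resultant p p^`()).
have frameE t i (k : 'I_(n.+1 * n.+1)) :
    frame_mx (B t) i k = tnth (B t) i (enum_val (cast_ord (esym (mxvec_cast _ _)) k)).1
                                      (enum_val (cast_ord (esym (mxvec_cast _ _)) k)).2.
  by case/mxvec_indexP: k => r s; rewrite mxE mxvecE /mxvec_index cast_ordK enum_rankK.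
move=> t; split=> // d F Fhom Fcartan.
(* The value of F on the moving frame is polynomial in s and vanishes wherever the discriminant does
   not, hence everywhere. *)
have FB0 s : F.@[plucker (frame_mx (B s))] = 0.
  move: s; apply: (@polyfun_eq0 _ _ disc t0) => //; last 2 first.
  - by rewrite disc_sep.
  - move=> s; rewrite disc_sep => sep_s; apply: (Fcartan _ _ (B s)).
      apply: cartan_criterion (Bsl s) (dimB s) sep_s _ => Y /coord_span->.
      rewrite mulmx_suml mulmx_sumr; apply: eq_bigr => i _.
      by rewrite -scalemxAl -scalemxAr -tnth_nth commB.
    by rewrite basisEfree freeB subvv size_tuple dimB leqnn.
  apply: fsubalg_meval => // i; apply: fsubalg_det => // a b.
  apply: fsubalg_ext (polyB a _ _) => // s.
  by rewrite [RHS]mxE frameE.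
(* Another basis multiplies all Pluecker coordinates by one determinant, which is harmless as F is
   homogeneous. *)
move=> b bU; pose M0 : 'M[K]_n := \matrix_(i, j) coord (B t) j (tnth b i).
have -> : frame_mx b = M0 *m frame_mx (B t).
  apply/row_matrixP => i; rewrite row_mul rowK mulmx_sum_row.
  rewrite {1}(coord_span (mem_basis_tnth i bU)) linear_sum; apply: eq_bigr => j _.
  by rewrite linearZ /= rowK 2!mxE (tnth_nth 0 (B t)).
rewrite (meval_eq _ (pluecker_mull _ _)) (meval_dhomog_scale _ _ Fhom) FB0 mulr0 //.
Qed.

End CartanCriterion.

(** * Points of Red(4) that come from pencils of conics *)

Section QuarticSubspaces.
Variable K : numClosedFieldType.
Implicit Types (W : nat -> nat -> K) (Q : 'M[K]_4).

Definition quartic_frame Q W : 3.-tuple 'M[K]_4 :=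
  [tuple invmx Q *m quartic_mx W i *m Q | i < 3].

Lemma polyfun_quartic_mx (W : K -> nat -> nat -> K) j r s :
  (forall u v, polyfun (fun t => W t u v)) ->
  polyfun (fun t => quartic_mx (W t) j r s).
Proof.
move=> polyW; have alg := polyfun_subalgebra K.
have polyc i j' k : polyfun (fun t => struct_const (W t) i j' k).
  by apply: (fsubalgB alg).
have polyd i j' : polyfun (fun t => struct_const0 (W t) i j').
  have sum3P (f : nat -> K -> K) : (forall m, polyfun (f m)) ->
      polyfun (fun t => sum3 (fun m => f m t)).
    by move=> Pf; apply: (fsubalgD alg) => //; apply: (fsubalgD alg).
  apply: (fsubalgZ alg); apply: (sum3P) => l; apply: (sum3P) => m.
  exact: (fsubalgM alg).
pose f t := match r : nat, s : nat with
    | 0, s => (s == j.+1)%:R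
    | r.+1, 0 => struct_const0 (W t) r j
    | r.+1, s.+1 => struct_const (W t) r j s
    end.
apply: (@fsubalg_ext _ _ _ alg f) => [t | ]; first by rewrite mxE.
rewrite /f; case: (nat_of_ord r) => [|r']; first exact: (fsubalgC alg).
by case: (nat_of_ord s).
Qed.

Lemma eq_quartic_mx W W' j : W =2 W' -> quartic_mx W j = quartic_mx W' j.
Proof.
move=> E; have scE i j' k : struct_const W i j' k = struct_const W' i j' k.
  by rewrite /struct_const !E.
apply/matrixP => r s; rewrite !mxE; case: (nat_of_ord r) => // r'.
by case: (nat_of_ord s) => [|s']; rewrite ?scE // /struct_const0 /sum3 !scE.
Qed.

Lemma quartic_mx_row0 W j (s : 'I_4) : quartic_mx W j ord0 s = (s == j.+1 :> nat)%:R.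
Proof. by rewrite mxE. Qed.

(** Rows 0 of the three multiplications are distinct unit vectors, whatever W is. *)
Lemma free_quartic_frame Q W : Q \in unitmx -> free (quartic_frame Q W).
Proof.
move=> uQ; apply/freeP => k kX0 i.
have : \sum_(j < 3) k j *: quartic_mx W j = 0.
  transitivity (Q *m (invmx Q *m (\sum_(j < 3) k j *: quartic_mx W j) *m Q) *m invmx Q).
    by rewrite !mulmxA mulmxV // mul1mx mulmxK.
  have -> : invmx Q *m (\sum_(j < 3) k j *: quartic_mx W j) *m Q = 0.
    rewrite -[RHS]kX0 mulmx_sumr mulmx_suml; apply: eq_bigr => j _.
    by rewrite -scalemxAr -scalemxAl -tnth_nth tnth_mktuple.
  by rewrite mulmx0 mul0mx.
have lt_i : (i.+1 < 4)%N by rewrite ltnS.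
move=> /matrixP/(_ ord0 (Ordinal lt_i)); rewrite [RHS]mxE summxE (bigD1 i) //=.
rewrite mxE quartic_mx_row0 eqxx mulr1 big1 ?addr0 // => j /negPf ij.
by rewrite mxE quartic_mx_row0 /= eqSS eq_sym val_eqE ij mulr0.
Qed.

Lemma Red_quartic_frame Q (a b : nat -> K) : Q \in unitmx ->
  Red <<quartic_frame Q (fun u v => a u * b v - a v * b u)>>%VS.
Proof.
move=> uQ; have alg := polyfun_subalgebra K; have poly_id := polyfun_id K.
(* The pencil of conics through the points (1:0:0), (0:1:0), (0:0:1), (1:1:1). *)
pose a0 := nth 0 [:: 0; 0; 0; 1; 0; -1 : K]; pose b0 := nth 0 [:: 0; 0; 0; 0; -1; 1 : K].
pose lin (x0 x : nat -> K) t u := x0 u + t * (x u - x0 u).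
pose W t u v := lin a0 a t u * lin b0 b t v - lin a0 a t v * lin b0 b t u.
pose B t := quartic_frame Q (W t).
(* The weights 1, 2, 3 make this element take distinct values at the four points when t = 0. *)
pose X t := \sum_(i < 3) i.+1%:R *: tnth (B t) i.
have poly_lin x0 x u : polyfun (fun t => lin x0 x t u).
  apply: (fsubalgD alg); first exact: (fsubalgC alg).
  by apply: (fsubalgM alg) => //; apply: (fsubalgC alg).
have polyW u v : polyfun (fun t => W t u v).
  by apply: (fsubalgB alg); apply: (fsubalgM alg).
have polyB i r s : polyfun (fun t => tnth (B t) i r s).
  apply: (@fsubalg_ext _ _ _ alg (fun t => (invmx Q *m quartic_mx (W t) i *m Q) r s)).
    by move=> t; rewrite tnth_mktuple.
  apply: (fsubalg_mulmx alg) => *; last exact: (fsubalgC alg).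
  apply: (fsubalg_mulmx alg) => *; first exact: (fsubalgC alg).
  exact: polyfun_quartic_mx.
have comm t i j : tnth (B t) i *m tnth (B t) j = tnth (B t) j *m tnth (B t) i.
  rewrite !tnth_mktuple !mulmxA !mulmxK // -!(mulmxA (invmx Q)).
  by rewrite (@quartic_mx_comm _ (lin a0 a t) (lin b0 b t)).
have -> : quartic_frame Q (fun u v => a u * b v - a v * b u) = B 1.
  apply: eq_from_tnth => i; rewrite !tnth_mktuple; congr (_ *m _ *m _).
  have lin1 x0 x u : lin x0 x 1 u = x u by rewrite /lin mul1r addrC subrK.
  have WE u v : W 1 u v = a u * b v - a v * b u by rewrite /W !lin1.
  by apply: eq_quartic_mx => u v; rewrite WE.
apply: (@Red_line _ _ B X 0) => //.
- move=> r s; apply: (@fsubalg_ext _ _ _ alg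
    (fun t => \sum_(i < 3) i.+1%:R * tnth (B t) i r s)).
    by move=> t; rewrite summxE; apply: eq_bigr => i _; rewrite mxE.
  by apply: (fsubalg_sum alg) => i; apply: (fsubalgZ alg).
- by move=> t; apply: free_quartic_frame.
- move=> t i; rewrite tnth_mktuple mxtrace_mulC mulmxA mulmxV // mul1mx.
  by apply: trace_quartic_mx => // u v _ _; rewrite /W; ring.
- move=> t i; rewrite mulmx_sumr mulmx_suml; apply: eq_bigr => j _.
  by rewrite -scalemxAl -scalemxAr comm.
(* At t = 0 each xi takes the value 3 at one of the four points and -1 at the others. So x0 + 2 x1 +
   3 x2 has these values, and the eigenvectors [v0] are multiples of the idempotents: 1 - x0 - x1 -
   x2 and the 1 + xi. *)
pose ev (i : 'I_4) : K := (nth 0%Z [:: -6%:Z; -2%:Z; 2%:Z; 6%:Z] i)%:~R.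
pose v0 (i : 'I_4) : 'rV[K]_4 := \row_(s < 4)
  nth 0 (nth [::] [:: [:: 1; -1; -1; -1]; [:: 1; 1; 0; 0]; [:: 1; 0; 1; 0]; [:: 1; 0; 0; 1]] i) s.
apply: (@separable_eigen _ _ _ ev (fun i => v0 i *m Q)).
- move=> i j /(@intr_inj K).
  by case: i => [[|[|[|[|//]]]] i4]; case: j => [[|[|[|[|//]]]] j4] //= _; apply: val_inj.
- move=> i; apply/negP => /eqP E.
  have := congr1 (mulmx^~ (invmx Q)) E; rewrite mulmxK // mul0mx => /rowP/(_ ord0).
  by rewrite !mxE; case: i {E} => [[|[|[|[|//]]]] i4] /= /eqP; rewrite oner_eq0.
move=> i; rewrite /X.
have -> : \sum_(k < 3) k.+1%:R *: tnth (B 0) k =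
    invmx Q *m (\sum_(k < 3) k.+1%:R *: quartic_mx (W 0) k) *m Q.
  rewrite mulmx_sumr mulmx_suml; apply: eq_bigr => k _.
  by rewrite tnth_mktuple -scalemxAr -scalemxAl.
rewrite !mulmxA mulmxK // scalemxAl; congr (_ *m Q).
have lin0 x0 x u : lin x0 x 0 u = x0 u by rewrite /lin mul0r addr0.
have WE u v : W 0 u v = a0 u * b0 v - a0 v * b0 u by rewrite /W !lin0.
(* These constants encode xi^2 = 3 + 2 xi and (xi + 1)(xj + 1) = 0 for distinct i and j. *)
pose c0 (i j k : nat) : K :=
  if i == j then (k == i)%:R *+ 2 else - ((k == i) || (k == j))%:R.
pose d0 (i j : nat) : K := if i == j then 3%:R else -1.
have cE i' j k : (i' < 3)%N -> (j < 3)%N -> (k < 3)%N -> struct_const (W 0) i' j k = c0 i' j k.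
  move=> i3 j3 k3; rewrite /struct_const !WE /conic_index.
  by case: i' i3 => [|[|[|//]]] _; case: j j3 => [|[|[|//]]] _;
    case: k k3 => [|[|[|//]]] _; rewrite /a0 /b0 /c0 /=; ring.
have dE i' j : (i' < 3)%N -> (j < 3)%N -> struct_const0 (W 0) i' j = d0 i' j.
  move=> i3 j3; rewrite /struct_const0 /sum3 !cE //.
  by case: i' i3 => [|[|[|//]]] _; case: j j3 => [|[|[|//]]] _; rewrite /c0 /d0 /=; field.
have XE j : (j < 3)%N -> quartic_mx (W 0) j = alg_mx c0 d0 j.
  move=> j3; apply/matrixP => -[[|r] r4] [[|s] s4]; rewrite !mxE //=; first exact: dE.
  exact: cE.
have -> : \sum_(k < 3) k.+1%:R *: quartic_mx (W 0) k =
    alg_mx c0 d0 0 + 2%:R *: alg_mx c0 d0 1 + 3%:R *: alg_mx c0 d0 2.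
  by rewrite !big_ord_recl big_ord0 addr0 /= !XE // scale1r addrA.
apply/rowP => s; rewrite mxE !big_ord_recl !big_ord0 !mxE /ev.
case: i => [[|[|[|[|//]]]] i4]; case: s => [[|[|[|[|//]]]] s4];
  rewrite /= /c0 /d0 /=; ring.
Qed.

End QuarticSubspaces.

(** * The orbit of lines *)

Section LineOrbits.
Variable K : fieldType.
Implicit Types (v : 'cV[K]_4) (R : 'M[K]_(3, 4)) (U : {vspace 'M[K]_4}).

Definition line_frame v R : 3.-tuple 'M[K]_4 := [tuple v *m row i R | i < 3].

Lemma line_mx_factor v (x : 'M[K]_4) :
  (forall u : 'cV[K]_4, x *m u \in <[v]>%VS) -> exists r : 'rV[K]_4, x = v *m r.
Proof.
move=> xV.
have /fin_all_exists[c cP] : forall k : 'I_4, exists c, col k x = c *: v.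
  by move=> k; rewrite colE; apply/vlineP.
exists (\row_k c k); apply/matrixP => i k; rewrite !mxE big_ord1 !mxE.
by have /matrixP/(_ i 0) := cP k; rewrite !mxE mulrC.
Qed.

Lemma mulmx_cV_eq0 v (r : 'rV[K]_4) : v != 0 -> v *m r = 0 -> r = 0.
Proof.
move=> /matrix0Pn[i [j]]; rewrite ord1 => vi vr; apply/rowP => k; rewrite [RHS]mxE.
have /matrixP/(_ i k) := vr; rewrite !mxE big_ord1 => /eqP.
by rewrite mulf_eq0 (negPf vi) => /eqP.
Qed.

Lemma line_frameP v R : v != 0 -> row_free R -> R *m v = 0 -> forall x,
  x \in <<line_frame v R>>%VS <->
  (forall u : 'cV[K]_4, x *m u \in <[v]>%VS) /\
  (forall u : 'cV[K]_4, u \in <[v]>%VS -> x *m u = 0).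
Proof.
move=> v0 Rfree Rv x; split=> [/coord_span-> | [xV xv]].
  set k := fun i => coord (line_frame v R) i x.
  have -> : \sum_(i < 3) coord (line_frame v R) i x *: (line_frame v R)`_i =
      v *m (\row_i k i *m R).
    rewrite mulmx_sum_row mulmx_sumr; apply: eq_bigr => i _.
    by rewrite -scalemxAr mxE -tnth_nth tnth_mktuple.
  split=> u; last first.
    by move=> /vlineP[c ->]; rewrite -scalemxAr -!mulmxA Rv !mulmx0 scaler0.
  apply/vlineP; rewrite -mulmxA; set z := _ *m u; exists (z 0 0).
  by rewrite [z]mx11_scalar mul_mx_scalar !mxE.
have [r Er] := line_mx_factor xV.
have rv : r *m v = 0.
  have := xv v (memv_line v); rewrite Er -mulmxA [_ *m v]mx11_scalar mul_mx_scalar.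
  move/eqP; rewrite scaler_eq0 (negPf v0) orbF => /eqP ->.
  by rewrite -scalemx1 scale0r.
have RK : (R <= kermx v)%MS by apply/sub_kermxP.
have KR : (kermx v <= R)%MS.
  rewrite -(geq_leqif (mxrank_leqif_sup RK)) mxrank_ker (eqP Rfree).
  by rewrite leq_subLR -[4%N]/(1 + 3)%N leq_add2r lt0n mxrank_eq0.
have /submxP[k rk] : (r <= R)%MS.
  by apply: submx_trans KR; apply/sub_kermxP.
rewrite Er rk mulmx_sum_row mulmx_sumr; apply: memv_suml => i _.
rewrite -scalemxAr; apply/memvZ/memv_span.
by have <- : tnth (line_frame v R) i = v *m row i R; [rewrite tnth_mktuple | apply: mem_tnth].
Qed.

Lemma free_line_frame v R : v != 0 -> row_free R -> free (line_frame v R).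
Proof.
move=> v0 Rfree; apply/freeP => k kX0 i.
have: v *m (\row_i k i *m R) = 0.
  rewrite -[RHS]kX0 mulmx_sum_row mulmx_sumr; apply: eq_bigr => j _.
  by rewrite -scalemxAr mxE -tnth_nth tnth_mktuple.
move=> /(mulmx_cV_eq0 v0); rewrite -[RHS](mul0mx _ R) => /(row_free_inj Rfree).
by move=> /rowP/(_ i); rewrite !mxE.
Qed.

Lemma line_orbit_line_frame v R : v != 0 -> row_free R -> R *m v = 0 ->
  line_orbit <<line_frame v R>>%VS.
Proof.
move=> v0 Rfree Rv; exists <[v]>%VS; first by rewrite dim_vline v0.
exact: line_frameP.
Qed.

Lemma line_orbitE U : line_orbit U ->
  exists v R, [/\ v != 0, row_free R, R *m v = 0 & U = <<line_frame v R>>%VS].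
Proof.
move=> [V dV UV]; pose v := vpick V.
have v0 : v != 0 by rewrite vpick0 -dimv_eq0 dV.
have EV : V = <[v]>%VS.
  by apply/esym/eqP; rewrite eqEdim dim_vline v0 dV leqnn andbT; apply: memv_pick.
have rk : \rank (kermx v) = 3%N.
  have : (\rank v <= 1)%N by apply: rank_leq_col.
  have : (0 < \rank v)%N by rewrite lt0n mxrank_eq0.
  by rewrite mxrank_ker; case: (\rank v) => [|[|]].
have [k [R [k3 Rfree Rv]]] : exists k (R : 'M[K]_(k, 4)), [/\ k = 3, row_free R & R *m v = 0].
  exists (\rank (kermx v)), (row_base (kermx v)); split; rewrite ?row_base_free //.
  by apply/sub_kermxP; rewrite eq_row_base.
subst k; rewrite {}EV in UV; exists v, R; split=> //.
apply/vspaceP => x; apply/idP/idP.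
  by move=> /UV xv; apply/(line_frameP v0 Rfree Rv).
by move=> xv; apply/UV/(line_frameP v0 Rfree Rv).
Qed.

(** Write ei = v ri with ri v = 0 and add a row r0 with r0 v = 1. The matrix Q with these four rows
    sends v to the first unit vector, so any basis of a point of the orbit takes the same normal
    form. *)
Lemma line_orbit_frame U (e : 3.-tuple 'M[K]_4) : line_orbit U -> basis_of U e ->
  exists2 Q : 'M[K]_4, Q \in unitmx &
    forall i, tnth e i = invmx Q *m delta_mx ord0 (lift ord0 i) *m Q.
Proof.
move=> [V dV UV] eU; pose v := vpick V.
have v0 : v != 0 by rewrite vpick0 -dimv_eq0 dV.
have EV : V = <[v]>%VS.
  by apply/esym/eqP; rewrite eqEdim dim_vline v0 dV leqnn andbT; apply: memv_pick.
rewrite {}EV in UV.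
have /fin_all_exists[r er] : forall i, exists r : 'rV[K]_4, tnth e i = v *m r.
  by move=> i; apply/line_mx_factor; have /UV[] := mem_basis_tnth i eU.
have rv i : r i *m v = 0.
  have /UV[_ /(_ v (memv_line v))] := mem_basis_tnth i eU.
  rewrite er -mulmxA [_ *m v]mx11_scalar mul_mx_scalar.
  move/eqP; rewrite scaler_eq0 (negPf v0) orbF => /eqP ->.
  by rewrite -scalemx1 scale0r.
have [l [j]] := matrix0Pn _ v0; rewrite ord1 => vl.
pose r0 : 'rV[K]_4 := (v l 0)^-1 *: delta_mx 0 l.
have r0v : r0 *m v = 1%:M.
  rewrite -scalemxAl -rowE; apply/matrixP => a b.
  by rewrite !ord1 !mxE mulVf.
pose Q : 'M[K]_4 := \matrix_i (if unlift ord0 i is Some k then r k else r0).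
have Qlift i : row (lift ord0 i) Q = r i by rewrite rowK liftK.
have Q0 : row ord0 Q = r0 by rewrite rowK unlift_none.
have Qv : Q *m v = delta_mx ord0 0.
  apply/row_matrixP => i; rewrite row_mul; case: (unliftP ord0 i) => [k|] ->.
    rewrite Qlift rv; apply/matrixP => a b; rewrite !ord1 !mxE.
    by rewrite eq_sym (negPf (neq_lift _ _)).
  rewrite Q0 r0v; apply/matrixP => a b; rewrite !ord1 !mxE.
  by rewrite !eqxx.
(* For a row a with a Q = 0, multiplying by v kills the coefficient of r0; freeness of [e] kills the
   other three. *)
have uQ : Q \in unitmx.
  rewrite -row_free_unit -kermx_eq0; apply/eqP/row_matrixP => i0; rewrite row0.
  set a := row i0 _; have aQ : a *m Q = 0 by apply/sub_kermxP; apply: row_sub.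
  have a0 : a 0 ord0 = 0.
    have := congr1 (mulmx^~ v) aQ; rewrite mul0mx -mulmxA Qv -colE => /matrixP/(_ 0 0).
    by rewrite !mxE.
  have : \sum_(i < 3) a 0 (lift ord0 i) *: e`_i = 0.
    have vaQ : v *m (a *m Q) = 0 by rewrite aQ mulmx0.
    rewrite -[RHS]vaQ mulmx_sum_row [in RHS]big_ord_recl a0 scale0r add0r mulmx_sumr.
    by apply: eq_bigr => i _; rewrite Qlift -scalemxAr -er -tnth_nth.
  have /freeP eF := basis_free eU; move=> /eF aL.
  by apply/rowP => k; rewrite [RHS]mxE; case: (unliftP ord0 k) => [k'|] ->.
exists Q => // i; rewrite er -(Qlift i) rowE -[in LHS](mulKmx uQ v) Qv -!mulmxA.
by rewrite [delta_mx _ _ *m (_ *m _)]mulmxA mul_delta_mx.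
Qed.

End LineOrbits.

(** These are the subspaces of the zero form, whose algebra has all products xi xj equal to 0. *)
Lemma line_orbit_Red (K : numClosedFieldType) (U : {vspace 'M[K]_4}) :
  line_orbit U -> Red U.
Proof.
move=> lU; have [v [R [v0 Rfree Rv EU]]] := line_orbitE lU.
have eU : basis_of U (line_frame v R).
  by rewrite EU /basis_of eqxx free_line_frame.
have [Q uQ eQ] := line_orbit_frame lU eU.
have := Red_quartic_frame (fun=> 0) (fun=> 0) uQ.
congr (Red _); rewrite EU; congr (<< val _ >>%VS); apply: eq_from_tnth => i.
rewrite eQ tnth_mktuple; congr (_ *m _ *m _).
have c0 i' j k : @struct_const K (fun=> fun=> 0 * 0 - 0 * 0) i' j k = 0.
  by rewrite /struct_const; ring.
apply/matrixP => -[[|r] r4] s; rewrite !mxE.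
  by rewrite -!val_eqE.
by case: s => [[|s] s4]; rewrite /= ?c0 // /struct_const0 /sum3 !c0 mulr0 !addr0 mulr0.
Qed.

Lemma span_mulmx (K : fieldType) (V : vectType K) k (A : 'M[K]_k) (b : k.-tuple V) :
  A \in unitmx ->
  <<[tuple (\sum_j A i j *: tnth b j)%R | i < k]>>%VS = <<b>>%VS.
Proof.
have sub (C : 'M[K]_k) (c : k.-tuple V) :
    (<<[tuple (\sum_j C i j *: tnth c j)%R | i < k]>> <= <<c>>)%VS.
  apply/span_subvP => _ /tnthP[i ->]; rewrite tnth_mktuple.
  by apply: memv_suml => j _; apply/memvZ/memv_span/mem_tnth.
move=> uA; apply/eqP; rewrite eqEsubv sub /=.
pose c : k.-tuple V := [tuple (\sum_j A i j *: tnth b j) | i < k]; rewrite -/c.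
apply: subv_trans (sub (invmx A) c).
have -> : [tuple (\sum_j invmx A i j *: tnth c j) | i < k] = b.
  apply: eq_from_tnth => i; rewrite tnth_mktuple.
  under eq_bigr => j _ do rewrite tnth_mktuple scaler_sumr.
  rewrite exchange_big /= -[RHS]scale1r (bigD1 i) //= [X in _ + X]big1 => [|l li].
    rewrite addr0; under eq_bigr => j _ do rewrite scalerA.
    rewrite -scaler_suml; congr (_ *: _).
    by have /matrixP/(_ i i) := mulVmx uA; rewrite !mxE eqxx => ->.
  under eq_bigr => j _ do rewrite scalerA.
  rewrite -scaler_suml; have /matrixP/(_ i l) := mulVmx uA; rewrite !mxE => ->.
  by rewrite eq_sym (negPf li) scale0r.
exact: subvv.
Qed.

(** * Curves read in a chart of the Grassmannian *)

Section Charts.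
Variables (K : numFieldType) (k m n : nat) (L : {vspace 'M[K]_n}).
Variables (e : k.-tuple 'M[K]_n) (w : m.-tuple 'M[K]_n).
Hypothesis ewL : basis_of L (e ++ w).

Definition ecoord (i : 'I_k) (x : 'M[K]_n) : K := coord [tuple of e ++ w] (lshift m i) x.
Definition wcoord (j : 'I_m) (x : 'M[K]_n) : K := coord [tuple of e ++ w] (rshift k j) x.

Lemma ewcoordE x : x \in L ->
  x = \sum_i ecoord i x *: tnth e i + \sum_j wcoord j x *: tnth w j.
Proof.
rewrite -(span_basis ewL) => /(@coord_span _ _ _ [tuple of e ++ w]) {1}->.
rewrite big_split_ord /=; congr (_ + _); apply: eq_bigr => i _; congr (_ *: _).
  by rewrite nth_cat size_tuple ltn_ord -tnth_nth.
by rewrite nth_cat size_tuple ltnNge leq_addr /= addKn -tnth_nth.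
Qed.

Lemma free_ew : free [tuple of e ++ w].
Proof. exact: basis_free ewL. Qed.

Lemma wcoord_e i j : wcoord i (tnth e j) = 0.
Proof.
have -> : tnth e j = [tuple of e ++ w]`_(lshift m j).
  by rewrite /= nth_cat size_tuple ltn_ord -tnth_nth.
by rewrite /wcoord coord_free ?free_ew // eq_lrshift.
Qed.

Lemma wcoord_w i j : wcoord i (tnth w j) = (i == j)%:R.
Proof.
have -> : tnth w j = [tuple of e ++ w]`_(rshift k j).
  by rewrite /= nth_cat size_tuple ltnNge leq_addr /= addKn -tnth_nth.
by rewrite /wcoord coord_free ?free_ew // eq_rshift eq_sym.
Qed.

Lemma w_in_L i : tnth w i \in L.
Proof. by apply: (basis_mem ewL); rewrite mem_cat mem_tnth orbT. Qed.

Definition wcoord_mx (B : 'I_k -> 'M[K]_n) : 'rV[K]_(k * m) :=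
  mxvec (\matrix_(i, j) wcoord j (B i)).

Lemma wcoord_mxE (x : 'rV[K]_(k * m)) (B : 'I_k -> 'M[K]_n) :
  (forall i, exists2 z, z \in <<e>>%VS &
     B i = z + \sum_j vec_mx x i j *: tnth w j) -> wcoord_mx B = x.
Proof.
move=> Bx; rewrite -[RHS]vec_mxK; congr mxvec; apply/matrixP => i j; rewrite mxE.
have [z /coord_span-> ->] := Bx i.
rewrite /wcoord linearD !linear_sum /= big1 ?add0r => [|l _]; last first.
  by rewrite linearZ /= -tnth_nth -/(wcoord j _) wcoord_e mulr0.
rewrite (bigD1 j) //= linearZ /= -/(wcoord j _) wcoord_w eqxx mulr1 big1 ?addr0 //.
move=> l lj; rewrite linearZ /= -/(wcoord j _) wcoord_w.
by rewrite eq_sym (negPf lj) mulr0.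
Qed.

Section Curve.
Variables (S : {vspace 'M[K]_n} -> Prop) (B1 B2 : 'I_k -> 'M[K]_n).
Hypotheses (LB1 : forall i, B1 i \in L) (LB2 : forall i, B2 i \in L).
Hypothesis SB : forall t,
  S <<[tuple (tnth e i + t *: B1 i + t ^+ 2 *: B2 i)%R | i < k]>>%VS.

(** The frame has [e]-part M(t) with M(0) = 1 and [w]-part t W(t), so its chart coordinates are t
    M^-1 W = (t / det M) adj(M) W. Only [B1] contributes to the tangent vector at t = 0. *)
Lemma chart_curve : exists (y : K -> 'I_(k * m) -> K) (u : K -> K),
  [/\ forall i, polyfun (fun t => y t i), polyfun u, u 0 = 1,
      forall t, u t != 0 -> S (chart e w (\row_i (t / u t * y t i)))
    & y 0 =1 wcoord_mx B1 0].
Proof.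
have alg := polyfun_subalgebra K; have poly_id := polyfun_id K.
pose M t : 'M[K]_k :=
  \matrix_(i, j) ((j == i)%:R + t * ecoord j (B1 i) + t ^+ 2 * ecoord j (B2 i)).
pose W t : 'M[K]_(k, m) := \matrix_(i, j) (wcoord j (B1 i) + t * wcoord j (B2 i)).
have polyM i j : polyfun (fun t => M t i j).
  apply: (@fsubalg_ext _ _ _ alg
    (fun t => (j == i)%:R + t * ecoord j (B1 i) + t ^+ 2 * ecoord j (B2 i))).
    by move=> t; rewrite mxE.
  apply: (fsubalgD alg); [apply: (fsubalgD alg) | apply: (fsubalgM alg)];
    [exact: (fsubalgC alg) | apply: (fsubalgM alg) | exact: (fsubalgX alg) |
     exact: (fsubalgC alg)] => //; exact: (fsubalgC alg).
have polyW i j : polyfun (fun t => W t i j).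
  apply: (@fsubalg_ext _ _ _ alg (fun t => wcoord j (B1 i) + t * wcoord j (B2 i))).
    by move=> t; rewrite mxE.
  apply: (fsubalgD alg); first exact: (fsubalgC alg).
  by apply: (fsubalgM alg) => //; apply: (fsubalgC alg).
have M0 : M 0 = 1%:M.
  by apply/matrixP => i j; rewrite !mxE mul0r expr0n /= mul0r !addr0 eq_sym.
have W0 : W 0 = \matrix_(i, j) wcoord j (B1 i).
  by apply/matrixP => i j; rewrite !mxE mul0r addr0.
exists (fun t i => mxvec (\adj (M t) *m W t) 0 i), (fun t => \det (M t)); split.
- move=> i; case/mxvec_indexP: i => i j.
  apply: (@fsubalg_ext _ _ _ alg (fun t => (\adj (M t) *m W t) i j)).
    by move=> t; rewrite mxvecE.
  by apply: (fsubalg_mulmx alg) => // *; apply: (fsubalg_adj alg).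
- exact: (fsubalg_det alg).
- by rewrite M0 det1.
- move=> t Mt; have uM : M t \in unitmx by rewrite unitmxE unitfE.
  suff <- : <<[tuple (tnth e i + t *: B1 i + t ^+ 2 *: B2 i)%R | i < k]>>%VS =
      chart e w (\row_i (t / \det (M t) * mxvec (\adj (M t) *m W t) 0 i)) by [].
  pose b : k.-tuple 'M[K]_n := [tuple tnth e i + t *: B1 i + t ^+ 2 *: B2 i | i < k].
  rewrite -/b.
  have uV : invmx (M t) \in unitmx by rewrite unitmx_inv.
  rewrite -(span_mulmx b uV); congr (<< val _ >>%VS); apply: eq_from_tnth => i.
  rewrite !tnth_mktuple.
  have bE j : tnth b j = \sum_l M t j l *: tnth e l + \sum_l (t * W t j l) *: tnth w l.
    rewrite tnth_mktuple [in LHS](ewcoordE (LB1 j)) [in LHS](ewcoordE (LB2 j)).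
    rewrite !scalerDr !scaler_sumr.
    have eE : tnth e j = \sum_l (l == j)%:R *: tnth e l.
      rewrite (bigD1 j) //= eqxx scale1r big1 ?addr0 // => l /negPf ->.
      by rewrite scale0r.
    rewrite [X in X + _ + _ = _]eE [X in X + _]addrA addrACA -!big_split /=.
    congr (_ + _); apply: eq_bigr => l _; last first.
      by rewrite !mxE !scalerA -scalerDl mulrDr mulrA.
    by rewrite !mxE !scalerA -!scalerDl.
  rewrite (eq_bigr (fun j => \sum_l (invmx (M t) i j * M t j l) *: tnth e l +
      \sum_l (invmx (M t) i j * (t * W t j l)) *: tnth w l)); last first.
    move=> j _; rewrite bE scalerDr !scaler_sumr.
    by congr (_ + _); apply: eq_bigr => l _; rewrite scalerA.
  rewrite big_split /= exchange_big [X in _ + X]exchange_big /=; congr (_ + _).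
    rewrite (bigD1 i) //= [X in _ + X]big1 => [|l li].
      rewrite addr0 -scaler_suml -[RHS]scale1r; congr (_ *: _).
      by have /matrixP/(_ i i) := mulVmx uM; rewrite !mxE eqxx => ->.
    rewrite -scaler_suml; have /matrixP/(_ i l) := mulVmx uM; rewrite !mxE => ->.
    by rewrite eq_sym (negPf li) scale0r.
  apply: eq_bigr => l _; rewrite -scaler_suml; congr (_ *: _).
  rewrite [vec_mx _ i l]mxE mxE mxvecE mxE big_distrr /=; apply: eq_bigr => j _.
  by rewrite /invmx uM !mxE; ring.
- by move=> i; rewrite M0 W0 adj1 mul1mx.
Qed.

End Curve.

End Charts.

(** * From commuting matrices to structure constants *)

Section Multiplications.
Variable K : numFieldType.
Implicit Types (b X : 'I_3 -> 'M[K]_4) (c : nat -> nat -> nat -> K).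

Lemma eq_omega c c' u v : (u < 6)%N -> (v < 6)%N ->
  (forall i j k, (i < 3)%N -> (j < 3)%N -> (k < 3)%N -> c i j k = c' i j k) ->
  omega c u v = omega c' u v.
Proof.
move=> u6 v6 cc'; rewrite /omega /sum3.
by case: u u6 => [|[|[|[|[|[|//]]]]]] _; case: v v6 => [|[|[|[|[|[|//]]]]]] _;
  rewrite /= !cc'.
Qed.

Lemma eq_wedge_row n (W W' : nat -> nat -> K) :
  (forall u v, (u < n)%N -> (v < n)%N -> W u v = W' u v) -> wedge_row n W = wedge_row n W'.
Proof. by move=> WW'; apply/rowP => i; rewrite !mxE WW'. Qed.

(** The change of the constants when each xi is replaced by xi + a i. *)
Definition translation (a : nat -> K) i j k : K := a i * (j == k)%:R + a j * (i == k)%:R.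

Lemma omega_translation a u v : (u < 6)%N -> (v < 6)%N -> omega (translation a) u v = 0.
Proof.
move=> u6 v6; rewrite /omega /sum3 /translation.
by case: u u6 => [|[|[|[|[|[|//]]]]]] _; case: v v6 => [|[|[|[|[|[|//]]]]]] _;
  rewrite /=; ring.
Qed.

Lemma omega_linear c c' (t : K) u v :
  omega (fun i j k => t * c i j k + c' i j k) u v = t * omega c u v + omega c' u v.
Proof.
rewrite /omega; case: (conic_pair u) => i a; case: (conic_pair v) => j b0.
by rewrite /sum3; ring.
Qed.

Lemma omega_scale c (t : K) u v : omega (fun i j k => t * c i j k) u v = t * omega c u v.
Proof.
rewrite /omega; case: (conic_pair u) => i a; case: (conic_pair v) => j b0.
by rewrite /sum3; ring.
Qed.

Lemma struct_const_omega c i j k : const_sym c -> (i < 3)%N -> (j < 3)%N -> (k < 3)%N ->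
  c i j k = struct_const (omega c) i j k
            + translation (fun i => 4%:R^-1 * sum3 (fun l => c i l l)) i j k.
Proof.
move=> /const_symE csym i3 j3 k3.
apply: (mulfI (_ : 4%:R != 0)); first by rewrite Num.Theory.pnatr_eq0.
rewrite mulrDr /struct_const /translation /omega /sum3.
by case: i i3 => [|[|[|//]]] _; case: j j3 => [|[|[|//]]] _;
  case: k k3 => [|[|[|//]]] _; rewrite /conic_index /= !csym; field.
Qed.

(** For a frame with e_0 x_j = e_j up to scalars, subtracting the corner entry makes x_j the
    multiplication by the j-th generator, and its lower block consists of structure constants. The
    expression is linear in X. *)
Definition lam X (i j k : nat) : K :=
  X (inord j) (inord i.+1) (inord k.+1) - (i == k)%:R * X (inord j) ord0 ord0.

Lemma sum_I4 (f : 'I_4 -> K) : \sum_s f s = f ord0 + sum3 (fun m => f (inord m.+1)).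
Proof.
rewrite !big_ord_recl big_ord0 addr0 /sum3 !addrA.
by congr (_ + _ + _ + _); congr f; apply: val_inj; rewrite /= inordK.
Qed.

Lemma inordS_neq0 i : (i < 3)%N -> (inord i.+1 == ord0 :> 'I_4) = false.
Proof. by move=> i3; rewrite -val_eqE /= inordK. Qed.

Lemma inordS_eq i j : (i < 3)%N -> (j < 3)%N -> (inord i.+1 == inord j.+1 :> 'I_4) = (i == j).
Proof. by move=> i3 j3; rewrite -val_eqE /= !inordK. Qed.

Lemma inord3_eq i j : (i < 3)%N -> (j < 3)%N -> (inord i == inord j :> 'I_3) = (i == j).
Proof. by move=> i3 j3; rewrite -val_eqE /= !inordK. Qed.

Lemma comm_cone X :
  (forall i j, X i *m X j = X j *m X i) ->
  (forall j s : 'I_3, X j ord0 (lift ord0 s) = (j == s)%:R) ->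
  grassmannian_cone (wedge_row 6 (omega (lam X))).
Proof.
move=> Xcomm X0; pose Y (j : nat) := X (inord j) - (X (inord j) ord0 ord0)%:M.
have Ycomm i j : Y i *m Y j = Y j *m Y i.
  rewrite /Y !mulmxBl !mulmxBr Xcomm !mul_mx_scalar !mul_scalar_mx !scale_scalar_mx.
  by rewrite !opprB addrACA [RHS]addrACA mulrC [X in _ + X = _]addrC.
have Y00 j : Y j ord0 ord0 = 0 by rewrite !mxE eqxx mulr1n subrr.
have liftE (s : nat) : (s < 3)%N -> inord s.+1 = lift ord0 (inord s : 'I_3) :> 'I_4.
  by move=> s3; apply: val_inj; rewrite /= !inordK.
have Y0 j s : (j < 3)%N -> (s < 3)%N -> Y j ord0 (inord s.+1) = (j == s)%:R.
  move=> j3 s3; rewrite !mxE eq_sym inordS_neq0 // mulr0n subr0 liftE // X0.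
  by rewrite inord3_eq.
have lamE i j k : (i < 3)%N -> (j < 3)%N -> (k < 3)%N ->
    lam X i j k = Y j (inord i.+1) (inord k.+1).
  by move=> i3 j3 k3; rewrite /lam !mxE inordS_eq // mulr_natl.
have YY i j l s : (i < 3)%N -> (j < 3)%N ->
    (Y i *m Y j) l s = Y i l ord0 * Y j ord0 s
      + sum3 (fun m => Y i l (inord m.+1) * Y j (inord m.+1) s).
  by move=> i3 j3; rewrite mxE sum_I4.
(* As e_0 Y_i is a unit vector, commutativity in row 0 is the symmetry of the structure constants;
   the other rows give [const_comm]. *)
have row0 i j s : (i < 3)%N -> (j < 3)%N -> (Y i *m Y j) ord0 s = Y j (inord i.+1) s.
  move=> i3 j3; rewrite YY // Y00 mul0r add0r /sum3 !Y0 //.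
  by case: i i3 => [|[|[|//]]] _; rewrite /= ?mul1r ?mul0r ?addr0 ?add0r.
have symY i j s : (i < 3)%N -> (j < 3)%N -> Y j (inord i.+1) s = Y i (inord j.+1) s.
  by move=> i3 j3; rewrite -!row0 // Ycomm.
pose d i j := Y j (inord i.+1) ord0.
apply: (@omega_cone _ (lam X) d).
- by move=> i j k i3 j3 k3; rewrite !lamE // symY.
- by move=> i j i3 j3; rewrite /d symY.
move=> i j l k i3 j3 l3 k3; rewrite /comm_defect /sum3 !lamE //.
have /matrixP/(_ (inord l.+1) (inord k.+1)) := Ycomm i j.
rewrite !YY // !Y0 // /sum3 /d => E; apply/eqP.
have ifE (B : bool) (x : K) : (if B then x else 0) = x * B%:R.
  by case: B; rewrite (mulr1, mulr0).
rewrite !ifE; move/eqP: E; rewrite -subr_eq0 => /eqP <-; apply/eqP; ring.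
Qed.

Definition row0_mx b : 'M[K]_3 := \matrix_(i, s) b i ord0 (lift ord0 s).

(* The frame b is brought to the form e_0 x_j = e_j up to the factor det (row0_mx b), by the
   adjugate instead of the inverse to remain polynomial in b. *)
Definition adj_frame b (j : 'I_3) : 'M[K]_4 := \sum_l \adj (row0_mx b) j l *: b l.

Lemma adj_frame_row0 b (j s : 'I_3) :
  adj_frame b j ord0 (lift ord0 s) = \det (row0_mx b) * (j == s)%:R.
Proof.
have /matrixP/(_ j s) := mul_adj_mx (row0_mx b); rewrite !mxE mulr_natr => <-.
by rewrite summxE; apply: eq_bigr => l _; rewrite !mxE.
Qed.

Lemma lam_scale X (t : K) i j k : lam (fun j => t *: X j) i j k = t * lam X i j k.
Proof. by rewrite /lam !mxE; ring. Qed.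

Lemma eq_lam X X' i j k : X =1 X' -> lam X i j k = lam X' i j k.
Proof. by move=> XX'; rewrite /lam XX'. Qed.

Lemma lam_adj_frame b i j k :
  lam (adj_frame b) i j k = \sum_l \adj (row0_mx b) (inord j) l * lam b i l k.
Proof.
rewrite /lam /adj_frame !summxE big_distrr /= -sumrB; apply: eq_bigr => l _.
by rewrite inord_val !mxE; ring.
Qed.

Lemma grassmannian_coneZ m n (y : 'rV[K]_('C(n, m))) t :
  grassmannian_cone y -> grassmannian_cone (t *: y).
Proof. by move=> [A [c [rA ->]]]; exists A, (t * c); rewrite scalerA. Qed.

Section Normalized.
Variable b : 'I_3 -> 'M[K]_4.
Hypothesis det_b : \det (row0_mx b) != 0.

Definition normalized (j : 'I_3) : 'M[K]_4 := (\det (row0_mx b))^-1 *: adj_frame b j.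

Lemma normalized_row0 (j s : 'I_3) : normalized j ord0 (lift ord0 s) = (j == s)%:R.
Proof. by rewrite mxE adj_frame_row0 mulKf. Qed.

Lemma omega_normalized :
  wedge_row 6 (omega (lam (adj_frame b))) =
  \det (row0_mx b) *: wedge_row 6 (omega (lam normalized)).
Proof.
apply/rowP => i; rewrite !mxE -omega_scale; apply: eq_omega => // *.
by rewrite -lam_scale; apply: eq_lam => j; rewrite /normalized scalerA mulfV // scale1r.
Qed.

Lemma adj_frame_cone : (forall i j, b i *m b j = b j *m b i) ->
  grassmannian_cone (wedge_row 6 (omega (lam (adj_frame b)))).
Proof.
move=> bcomm; rewrite omega_normalized; apply: grassmannian_coneZ.
apply: comm_cone normalized_row0 => i j.
rewrite /normalized /adj_frame -!scalemxAl -!scalemxAr; congr (_ *: (_ *: _)).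
rewrite mulmx_suml [RHS]mulmx_sumr; apply: eq_bigr => l _.
rewrite mulmx_sumr mulmx_suml; apply: eq_bigr => l' _.
by rewrite -!scalemxAl -!scalemxAr bcomm !scalerA mulrC.
Qed.

(** On the orbit of lines the structure constants are those of a translation, which [omega] does not
    see. *)
Lemma adj_frame_line (v : 'cV[K]_4) (s : 'I_3 -> 'rV[K]_4) :
  (forall i, b i = v *m s i) -> (forall i, s i *m v = 0) ->
  wedge_row 6 (omega (lam (adj_frame b))) = 0.
Proof.
move=> bs sv; rewrite omega_normalized.
pose S j : 'rV[K]_4 := (\det (row0_mx b))^-1 *: \sum_l \adj (row0_mx b) j l *: s l.
have NE j : normalized j = v *m S j.
  rewrite /normalized /S -scalemxAr mulmx_sumr; congr (_ *: _).
  by apply: eq_bigr => l _; rewrite -scalemxAr bs.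
have Sv j : S j *m v = 0.
  rewrite /S -scalemxAl mulmx_suml big1 ?scaler0 // => l _.
  by rewrite -scalemxAl sv scaler0.
have NE' j r q : normalized j r q = v r 0 * S j 0 q by rewrite NE mxE big_ord1.
have v0S (j t : 'I_3) : v ord0 0 * S j 0 (lift ord0 t) = (j == t)%:R.
  by rewrite -NE' normalized_row0.
have v0 : v ord0 0 != 0.
  by apply/negP => /eqP E; have /eqP := v0S ord0 ord0; rewrite E mul0r eq_sym oner_eq0.
have ->: wedge_row 6 (omega (lam normalized)) = 0; last by rewrite scaler0.
apply/rowP => i; rewrite !mxE.
(* Normalization determines S_j except for its entry 0, and S_j v = 0 then gives the corner v_0 S_j0
   = - a j. *)
pose a i := v (inord i.+1) 0 / v ord0 0.
rewrite -(@omega_translation a (tnth (pluecker_tuple i) ord0) (tnth (pluecker_tuple i) ord_max)) //.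
apply: eq_omega => // i' j k i3 j3 k3.
rewrite /lam !NE' /translation.
have liftE (t : nat) : (t < 3)%N -> inord t.+1 = lift ord0 (inord t : 'I_3) :> 'I_4.
  by move=> t3; apply: val_inj; rewrite /= !inordK.
have SE t : (t < 3)%N -> S (inord j) 0 (inord t.+1) = (v ord0 0)^-1 * (j == t)%:R.
  by move=> t3; apply: (mulfI v0); rewrite mulVKf // liftE // v0S inord3_eq.
have S0 : v ord0 0 * S (inord j) 0 ord0 = - a j.
  have /matrixP/(_ 0 0) := Sv (inord j).
  rewrite [LHS]mxE [RHS]mxE sum_I4 /sum3 !SE // => E.
  apply/eqP; rewrite -addr_eq0 mulrC -[X in _ == X]E; apply/eqP; congr (_ + _).
  by rewrite /a; case: j j3 {SE E} => [|[|[|//]]] _ /=; ring.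
by rewrite S0 SE // /a eq_sym [i' == k]eq_sym; ring.
Qed.

End Normalized.

End Multiplications.

Section PolynomialFrames.
Variables (K : numFieldType) (T : Type) (S : (T -> K) -> Prop).
Hypothesis alg : fun_subalgebra S.

Lemma fsubalg_omega (c : T -> nat -> nat -> nat -> K) u v :
  (forall i j k, S (fun t => c t i j k)) -> S (fun t => omega (c t) u v).
Proof.
move=> Sc; rewrite /omega; case: (conic_pair u) => i a; case: (conic_pair v) => j b.
apply: (fsubalgZ alg).
have SZ x i' j' k' : S (fun t => x * c t i' j' k') by apply: (fsubalgZ alg).
by do !apply: (fsubalgD alg).
Qed.

Lemma fsubalg_lam (b : T -> 'I_3 -> 'M[K]_4) i j k :
  (forall l r s, S (fun t => b t l r s)) -> S (fun t => lam (b t) i j k).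
Proof. by move=> Sb; apply: (fsubalgB alg) => //; apply: (fsubalgZ alg). Qed.

Lemma fsubalg_row0_mx (b : T -> 'I_3 -> 'M[K]_4) i j :
  (forall l r s, S (fun t => b t l r s)) -> S (fun t => row0_mx (b t) i j).
Proof. by move=> Sb; apply: (fsubalg_ext alg) (Sb _ _ _) => t; rewrite mxE. Qed.

Lemma fsubalg_adj_frame (b : T -> 'I_3 -> 'M[K]_4) l r s :
  (forall l r s, S (fun t => b t l r s)) -> S (fun t => adj_frame (b t) l r s).
Proof.
move=> Sb; have : S (fun t => \sum_q \adj (row0_mx (b t)) l q * b t q r s).
  apply: (fsubalg_sum alg) => q; apply: (fsubalgM alg) => //.
  by apply: (fsubalg_adj alg) => *; apply: fsubalg_row0_mx.
by apply: (fsubalg_ext alg) => t; rewrite summxE; apply: eq_bigr => q _; rewrite !mxE.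
Qed.

End PolynomialFrames.

Section FrameLines.
Variable K : numFieldType.

Definition frame0 (i : 'I_3) : 'M[K]_4 := delta_mx ord0 (lift ord0 i).

Lemma row0_frame0 : row0_mx frame0 = 1%:M.
Proof. by apply/matrixP => i s; rewrite !mxE eqxx eq_sym (inj_eq lift_inj). Qed.

Lemma lam_frame0 i j k : (i < 3)%N -> lam frame0 i j k = 0.
Proof. by move=> i3; rewrite /lam !mxE inordS_neq0 // eqxx /= mulr0 subr0. Qed.

Lemma lamD (b b' : 'I_3 -> 'M[K]_4) i j k :
  lam (fun l => b l + b' l) i j k = lam b i j k + lam b' i j k.
Proof. by rewrite /lam !mxE; ring. Qed.

Lemma eq_row0_mx (b b' : 'I_3 -> 'M[K]_4) : b =1 b' -> row0_mx b = row0_mx b'.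
Proof. by move=> E; apply/matrixP => i s; rewrite !mxE E. Qed.

Lemma eq_adj_frame (b b' : 'I_3 -> 'M[K]_4) : b =1 b' -> adj_frame b =1 adj_frame b'.
Proof.
move=> E i; rewrite /adj_frame (eq_row0_mx E).
by apply: eq_bigr => l _; rewrite E.
Qed.

Variable B : 'I_3 -> 'M[K]_4.

Definition frame_line (t : K) (i : 'I_3) : 'M[K]_4 := frame0 i + t *: B i.

(** [lam] is linear in the frame and vanishes on [frame0], so along the line one factor t splits off
    exactly; the remaining dependence on t is in the adjugate. *)
Definition line_slope (t : K) (i j k : nat) : K :=
  \sum_l \adj (row0_mx (frame_line t)) (inord j) l * lam B i l k.

Lemma omega_frame_line t u v : (u < 6)%N -> (v < 6)%N ->
  omega (lam (adj_frame (frame_line t))) u v = t * omega (line_slope t) u v.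
Proof.
move=> u6 v6; rewrite -omega_scale; apply: eq_omega => // i j k i3 j3 k3.
rewrite lam_adj_frame big_distrr; apply: eq_bigr => l _ /=.
by rewrite /frame_line lamD lam_frame0 // add0r lam_scale mulrCA.
Qed.

Lemma row0_frame_line0 : row0_mx (frame_line 0) = 1%:M.
Proof. by rewrite -row0_frame0; apply/matrixP => i s; rewrite !mxE mul0r addr0. Qed.

Lemma omega_line_slope0 u v : (u < 6)%N -> (v < 6)%N ->
  omega (line_slope 0) u v = omega (lam B) u v.
Proof.
move=> u6 v6; apply: eq_omega => // i j k i3 j3 k3.
rewrite /line_slope row0_frame_line0 adj1 (bigD1 (inord j)) //= mxE eqxx mul1r.
rewrite big1 ?addr0 ?inordK // => l lj.
by rewrite mxE eq_sym (negPf lj) mul0r.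
Qed.

Lemma polyfun_frame_line l r s : polyfun (fun t => frame_line t l r s).
Proof.
have alg := polyfun_subalgebra K.
apply: (@fsubalg_ext _ _ _ alg (fun t => frame0 l r s + t * B l r s)).
  by move=> t; rewrite !mxE.
apply: (fsubalgD alg); first exact: (fsubalgC alg).
by apply: (fsubalgM alg); [apply: polyfun_id | apply: (fsubalgC alg)].
Qed.

Lemma polyfun_line_slope u v : polyfun (fun t => omega (line_slope t) u v).
Proof.
have alg := polyfun_subalgebra K.
apply: (fsubalg_omega alg) => i j k; apply: (fsubalg_sum alg) => l.
apply: (fsubalgM alg); last exact: (fsubalgC alg).
apply: (fsubalg_adj alg) => *; apply: (fsubalg_row0_mx alg) => *.
exact: polyfun_frame_line.
Qed.

End FrameLines.

(** * The form omega in a chart centred at p *)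

Section Chart.
Variables (K : numClosedFieldType) (e : 3.-tuple 'M[K]_4) (w : 12.-tuple 'M[K]_4).
Variable Q : 'M[K]_4.
Hypothesis ewL : basis_of (sl K 4) (e ++ w).
Hypothesis uQ : Q \in unitmx.
Hypothesis eQ : forall i, tnth e i = invmx Q *m frame0 K i *m Q.
Implicit Types (x : 'rV[K]_(3 * 12)) (g : {mpoly K['C(6, 2)]}).

Let Red4 x := Red (chart e w x).
Let O3 x := line_orbit (chart e w x).

Definition conj_by (A : 'M[K]_4) := Q *m A *m invmx Q.

Lemma conj_byK A : invmx Q *m conj_by A *m Q = A.
Proof. by rewrite /conj_by !mulmxA mulVmx // mul1mx mulmxKV. Qed.

Lemma conj_byVK A : conj_by (invmx Q *m A *m Q) = A.
Proof. by rewrite /conj_by !mulmxA mulmxV // mul1mx mulmxK. Qed.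

Lemma conj_byD A B : conj_by (A + B) = conj_by A + conj_by B.
Proof. by rewrite /conj_by mulmxDr mulmxDl. Qed.

Lemma conj_byZ t A : conj_by (t *: A) = t *: conj_by A.
Proof. by rewrite /conj_by -scalemxAr -scalemxAl. Qed.

Lemma conj_byM A B : conj_by (A *m B) = conj_by A *m conj_by B.
Proof. by rewrite /conj_by !mulmxA mulmxKV. Qed.

Lemma trace_conj_by A : \tr (conj_by A) = \tr A.
Proof. by rewrite /conj_by mxtrace_mulC mulmxA mulVmx // mul1mx. Qed.

Definition chart_shift x (i : 'I_3) : 'M[K]_4 :=
  conj_by (\sum_(j < 12) vec_mx x i j *: tnth w j).

Definition chart_frame x (i : 'I_3) : 'M[K]_4 := frame0 K i + chart_shift x i.

Lemma chart_frame_mem x i :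
  exists2 z, z \in chart e w x & chart_frame x i = conj_by z.
Proof.
exists (tnth e i + \sum_(j < 12) vec_mx x i j *: tnth w j).
  by apply: memv_span; apply/tnthP; exists i; rewrite tnth_mktuple.
by rewrite conj_byD eQ conj_byVK.
Qed.

Lemma chart_shift_linear t x x' i :
  chart_shift (t *: x + x') i = t *: chart_shift x i + chart_shift x' i.
Proof.
rewrite /chart_shift -conj_byZ -conj_byD scaler_sumr -big_split /=; congr conj_by.
by apply: eq_bigr => j _; rewrite linearP /= !mxE scalerDl scalerA.
Qed.

Lemma chart_frame_scale t x : chart_frame (t *: x) =1 frame_line (chart_shift x) t.
Proof.
move=> i; rewrite /chart_frame /frame_line; congr (_ + _).
have := chart_shift_linear t x 0 i; rewrite addr0 => ->.
rewrite [X in _ + X](_ : _ = 0) ?addr0 // /chart_shift big1 => [|j _].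
  by rewrite /conj_by mulmx0 mul0mx.
by rewrite linear0 mxE scale0r.
Qed.

(** The derivative of [chart_omega] at the origin: there the adjugate is the identity, and its own
    derivative is multiplied by [lam] of [frame0], which is 0. *)
Definition slice_fun x : 'rV[K]_('C(6, 2)) := wedge_row 6 (omega (lam (chart_shift x))).

Lemma slice_fun_linear : linear slice_fun.
Proof.
move=> t x x'; apply/rowP => i; rewrite !mxE -omega_linear.
apply: eq_omega => // i' j k _ _ _.
rewrite -lam_scale -lamD; apply: eq_lam => l; exact: chart_shift_linear.
Qed.

Definition slice_mx : 'M[K]_(3 * 12, 'C(6, 2)) :=
  \matrix_(r, i) slice_fun (delta_mx 0 r) 0 i.

Lemma mul_slice_mx x : x *m slice_mx = slice_fun x.
Proof.
pose fL := GRing.isLinear.Build _ _ _ _ slice_fun slice_fun_linear.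
pose F : {linear 'rV[K]_(3 * 12) -> 'rV[K]_('C(6, 2))} := HB.pack slice_fun fL.
rewrite -[slice_fun x]/(F x) [in RHS](row_sum_delta x) linear_sum mulmx_sum_row.
apply: eq_bigr => r _; rewrite linearZ; congr (_ *: _).
by apply/rowP => i; rewrite !mxE.
Qed.

Definition chart_det x : K := \det (row0_mx (chart_frame x)).
Definition chart_omega x : 'rV[K]_('C(6, 2)) :=
  wedge_row 6 (omega (lam (adj_frame (chart_frame x)))).

Lemma mpolyfun_chart_frame l r s : mpolyfun (fun x => chart_frame x l r s).
Proof.
have alg := mpolyfun_subalgebra K (3 * 12).
have : mpolyfun (fun x => frame0 K l r s +
    \sum_(j < 12) x 0 (mxvec_index l j) * conj_by (tnth w j) r s).
  apply: (fsubalgD alg); first exact: (fsubalgC alg).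
  apply: (fsubalg_sum alg) => j; apply: (fsubalgM alg); last exact: (fsubalgC alg).
  exact: mpolyfun_coord.
apply: (fsubalg_ext alg) => x.
rewrite [RHS]mxE /chart_shift /conj_by mulmx_sumr mulmx_suml summxE.
congr (_ + _); apply: eq_bigr => j _.
by rewrite -scalemxAr -scalemxAl [RHS]mxE [vec_mx _ _ _]mxE.
Qed.

Lemma mpolyfun_chart_det : mpolyfun chart_det.
Proof.
have alg := mpolyfun_subalgebra K (3 * 12).
apply: (fsubalg_det alg) => *; apply: (fsubalg_row0_mx alg) => *.
exact: mpolyfun_chart_frame.
Qed.

Lemma mpolyfun_chart_omega i : mpolyfun (fun x => chart_omega x 0 i).
Proof.
have alg := mpolyfun_subalgebra K (3 * 12).
apply: (fsubalg_ext alg (f := fun x => omega (lam (adj_frame (chart_frame x)))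
  (tnth (pluecker_tuple i) ord0) (tnth (pluecker_tuple i) ord_max))).
  by move=> x; rewrite mxE.
apply: (fsubalg_omega alg) => *; apply: (fsubalg_lam alg) => *.
by apply: (fsubalg_adj_frame alg) => *; apply: mpolyfun_chart_frame.
Qed.

Definition slope t x : 'rV[K]_('C(6, 2)) :=
  wedge_row 6 (omega (line_slope (chart_shift x) t)).

Lemma chart_omega_scale t x : chart_omega (t *: x) = t *: slope t x.
Proof.
apply/rowP => i; rewrite !mxE -omega_frame_line //; apply: eq_omega => // *.
exact/eq_lam/eq_adj_frame/chart_frame_scale.
Qed.

Lemma slope0 x : slope 0 x = x *m slice_mx.
Proof. by rewrite mul_slice_mx; apply: eq_wedge_row => *; apply: omega_line_slope0. Qed.

Lemma polyfun_slope x i : polyfun (fun t => slope t x 0 i).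
Proof.
have alg := polyfun_subalgebra K.
apply: (fsubalg_ext alg) (polyfun_line_slope (chart_shift x)
  (tnth (pluecker_tuple i) ord0) (tnth (pluecker_tuple i) ord_max)) => t.
by rewrite mxE.
Qed.

Lemma polyfun_chart_det x : polyfun (fun t => chart_det (t *: x)).
Proof.
have alg := polyfun_subalgebra K.
apply: (fsubalg_ext alg (f := fun t => \det (row0_mx (frame_line (chart_shift x) t)))).
  by move=> t; rewrite /chart_det (eq_row0_mx (chart_frame_scale _ _)).
apply: (fsubalg_det alg) => *; apply: (fsubalg_row0_mx alg) => *.
exact: polyfun_frame_line.
Qed.

Lemma chart_det0 x : chart_det (0 *: x) = 1.
Proof.
by rewrite /chart_det (eq_row0_mx (chart_frame_scale _ _)) row0_frame_line0 det1.
Qed.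

Lemma Red4_comm x i j : Red4 x ->
  chart_frame x i *m chart_frame x j = chart_frame x j *m chart_frame x i.
Proof.
move=> Rx; have [z zx ->] := chart_frame_mem x i; have [z' zx' ->] := chart_frame_mem x j.
by rewrite -!conj_byM (Red_comm Rx).
Qed.

Lemma chart_omega_cone x : Red4 x -> chart_det x != 0 -> grassmannian_cone (chart_omega x).
Proof.
by move=> Rx dx; apply: adj_frame_cone => // i j; apply: Red4_comm.
Qed.

Lemma chart_omega_line x : O3 x -> chart_det x != 0 -> chart_omega x = 0.
Proof.
move=> Ox dx; have [v [R [v0 Rf Rv Ex]]] := line_orbitE Ox.
have /fin_all_exists[s sP] : forall i, exists s : 'rV[K]_4,
    chart_frame x i = Q *m v *m s /\ s *m (Q *m v) = 0.
  move=> i; have [z zx ->] := chart_frame_mem x i.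
  rewrite Ex in zx; have [zV zv] := (line_frameP v0 Rf Rv z).1 zx.
  have [r zr] := line_mx_factor zV.
  have rv : r *m v = 0.
    have := zv v (memv_line v); rewrite zr -mulmxA [r *m v]mx11_scalar mul_mx_scalar.
    move/eqP; rewrite scaler_eq0 (negPf v0) orbF => /eqP ->.
    by rewrite -scalemx1 scale0r.
  exists (r *m invmx Q); rewrite /conj_by zr !mulmxA; split=> //.
  by rewrite mulmxKV.
by apply: (@adj_frame_line _ _ dx (Q *m v) s) => i; have [] := sP i.
Qed.

End Chart.

(** * Ideals of cones and linearity of tangent spaces *)

Section ConeIdeals.
Variable K : numFieldType.

Lemma tangent_cone_ideal_sum n (Z : 'rV[K]_n -> Prop) (I : Type) (r : seq I)
    (F : I -> {mpoly K[n]}) :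
  (forall i, tangent_cone_ideal Z (F i)) -> tangent_cone_ideal Z (\sum_(i <- r) F i).
Proof.
move=> ZF; elim: r => [|i r [s [sZ IHr]]].
  by rewrite big_nil; exists [::]; rewrite big_nil.
have [s' [s'Z Ei]] := ZF i.
rewrite big_cons Ei IHr; exists (s' ++ s); split; last by rewrite big_cat.
by move=> ag; rewrite mem_cat => /orP[/s'Z | /sZ].
Qed.

(** The cone is stable under scaling, so g vanishes on every line through one of its points,
    coefficient by coefficient in t. *)
Lemma grassmannian_ideal_pihomog k n (g : {mpoly K['C(n, k)]}) d :
  @grassmannian_ideal K k n g -> grassmannian_ideal (pihomog mdeg d g).
Proof.
move=> Gg y Gy; rewrite -coef_scale_poly (_ : scale_poly g (y 0) = 0) ?coef0 //.
apply: horner_eq0 => t; rewrite horner_scale_poly -[RHS](Gg (t *: y)).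
  by apply: meval_eq => i; rewrite mxE.
exact: grassmannian_coneZ.
Qed.

Lemma meval_pullback n m (phi : 'M[K]_(n, m)) g (x : 'rV[K]_n) :
  (pullback phi g).@[x 0] = g.@[(x *m phi) 0].
Proof.
rewrite /pullback comp_mpoly_meval; apply: meval_eq => j.
rewrite tnth_mktuple raddf_sum mxE; apply: eq_bigr => i _ /=.
by rewrite mevalZ mevalXU mulrC.
Qed.

Lemma tangent_space_linear n (Z : 'rV[K]_n -> Prop) t x y :
  tangent_space Z x -> tangent_space Z y -> tangent_space Z (t *: x + y).
Proof.
move=> Zx Zy f Zf; have Ex := Zx f Zf; have Ey := Zy f Zf.
rewrite (eq_bigr (fun i => t * ((f^`M(i)).@[fun=> 0] * x 0 i) +
  (f^`M(i)).@[fun=> 0] * y 0 i)); last by move=> i _; rewrite !mxE; ring.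
by rewrite big_split /= -big_distrr /= Ex Ey mulr0 addr0.
Qed.

Lemma tangent_space0 n (Z : 'rV[K]_n -> Prop) : tangent_space Z 0.
Proof. by move=> f _; rewrite big1 // => i _; rewrite mxE mulr0. Qed.

Lemma tangent_space_sub n (Z Z' : 'rV[K]_n -> Prop) x :
  (forall y, Z y -> Z' y) -> tangent_space Z x -> tangent_space Z' x.
Proof. by move=> ZZ' Zx f Z'f; apply: Zx => y /ZZ'; apply: Z'f. Qed.

(** Wedges of two unit vectors: the cone spans the whole space, which yields the surjectivity of
    phi. *)
Lemma delta_cone n (i : 'I_'C(n, 2)) : grassmannian_cone (delta_mx 0 i : 'rV[K]_('C(n, 2))).
Proof.
have val_inj_tuple (j : 'I_'C(n, 2)) : pluecker_tuple j = pluecker_tuple i -> j = i.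
  by move=> /enum_val_inj/cast_ord_inj.
have lt_t (j : 'I_'C(n, 2)) :
    (tnth (pluecker_tuple j) ord0 < tnth (pluecker_tuple j) ord_max)%N.
  have /(sorted_ltn_nth ltn_trans 0%N) := pluecker_tuple_sorted j.
  move=> /(_ 0%N 1%N); rewrite !inE size_map size_tuple => /(_ isT isT isT).
  have x0 : 'I_n := tnth (pluecker_tuple j) ord0.
  by rewrite !(nth_map x0) ?size_tuple // !(tnth_nth x0).
set u := tnth (pluecker_tuple i) ord0; set v := tnth (pluecker_tuple i) ord_max.
have uv : (u < v)%N := lt_t i.
pose A : 'M[K]_(2, n) := \matrix_(r, s) (s == if r == ord0 then u else v)%:R.
have det_A : plucker A i = 1.
  rewrite pluecker2E !mxE /= !eqxx mul1r -/u -/v [v == u]eq_sym.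
  by rewrite -val_eqE (ltn_eqF uv) mul0r subr0.
exists A, 1; split; last first.
  rewrite scale1r; apply/rowP => j; rewrite !mxE eqxx /=.
  have [-> // | ji] := eqVneq j i; apply/esym; rewrite pluecker2E !mxE /=.
  set u' := tnth _ ord0; set v' := tnth _ ord_max.
  have u'v' : (u' < v')%N := lt_t j.
  have [Eu | nu] := eqVneq u' u; last first.
    rewrite mul0r sub0r; have [E1 | _] := eqVneq v' u; last by rewrite mul0r oppr0.
    have [E2 | _] := eqVneq u' v; last by rewrite mulr0 oppr0.
    by move: u'v'; rewrite E1 E2 ltnNge ltnW.
  have [Ev | nv] := eqVneq v' v; last first.
    rewrite mulr0 sub0r; have [E1 | _] := eqVneq v' u; last by rewrite mul0r oppr0.
    by rewrite Eu E1 ltnn in u'v'.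
  case/negP: ji; apply/eqP/val_inj_tuple/eq_from_tnth => q.
  have : (q == ord0) || (q == ord_max) by case: q => [[|[|//]] q2].
  by case/orP => /eqP->.
apply/eqP; rewrite -[_ == _]/(row_free A); apply/row_freeP.
pose f (j : 'I_2) := if j == ord0 then u else v.
have dA : colsub f A \in unitmx.
  have -> : colsub f A = colsub (tnth (pluecker_tuple i)) A.
    apply/matrixP => a q; rewrite [LHS]mxE [RHS]mxE; congr (A a _).
    have : (q == ord0) || (q == ord_max) by case: q => [[|[|//]] q2].
    by case/orP => /eqP->.
  by rewrite unitmxE -[\det _]/(plucker A i) det_A unitr1.
exists (colsub f 1%:M *m invmx (colsub f A)).
by rewrite mulmxA mulmx_colsub mulmx1 mulmxV.
Qed.

End ConeIdeals.

(** * The tangent cone and the cone over G(2, 6) *)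

Section Slice.
Variables (K : numClosedFieldType) (e : 3.-tuple 'M[K]_4) (w : 12.-tuple 'M[K]_4).
Variable Q : 'M[K]_4.
Hypothesis ewL : basis_of (sl K 4) (e ++ w).
Hypothesis uQ : Q \in unitmx.
Hypothesis eQ : forall i, tnth e i = invmx Q *m frame0 K i *m Q.
Implicit Types (x : 'rV[K]_(3 * 12)) (g : {mpoly K['C(6, 2)]}).

Let Red4 x := Red (chart e w x).
Let O3 x := line_orbit (chart e w x).
Let phi := slice_mx w Q.

Lemma grassmannian_tangent_cone g :
  @grassmannian_ideal K 2 6 g -> tangent_cone_ideal Red4 (pullback phi g).
Proof.
move=> Gg; have alg := mpolyfun_subalgebra K (3 * 12); have alg1 := polyfun_subalgebra K.
rewrite [g](@pihomog_partitionE _ _ mdeg _ _ (leqnn (msize g))) /pullback raddf_sum /=.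
apply: tangent_cone_ideal_sum => d; rewrite -/(pullback phi _).
have /(_ d) := grassmannian_ideal_pihomog _ Gg.
move: (pihomog _ _ g) (pihomogP mdeg d g) => gd hom_gd Ggd.
(* The factor [chart_det] makes f vanish also at points of Red(4) whose frame cannot be normalized.
   It equals 1 at the origin and leaves the initial form unchanged. *)
have [f fE] : mpolyfun (fun x => chart_det w Q x * gd.@[chart_omega w Q x 0]).
  apply: (fsubalgM alg); first exact: mpolyfun_chart_det.
  by apply: (fsubalg_meval alg) => i; apply: mpolyfun_chart_omega.
exists [:: (1, pullback phi gd)]; split; last by rewrite big_seq1 mul1r.
move=> ag; rewrite inE => /eqP-> /=; exists f.
  move=> x Rx; rewrite -fE; have [-> | dx] := eqVneq (chart_det w Q x) 0.
    by rewrite mul0r.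
  by rewrite Ggd ?mulr0 //; apply: chart_omega_cone Rx dx.
apply: (@initial_formI _ _ _ _ d) => x.
exists (fun t => chart_det w Q (t *: x) * gd.@[slope w Q t x 0]).
  apply: (fsubalgM alg1); first exact: polyfun_chart_det.
  by apply: (fsubalg_meval alg1) => i; apply: polyfun_slope.
split=> [|t]; first by rewrite chart_det0 mul1r slope0 meval_pullback.
have <- : f.@[(t *: x) 0] = f.@[fun i => t * x 0 i].
  by apply: meval_eq => i; rewrite mxE.
rewrite -fE chart_omega_scale mulrCA; congr (_ * _).
rewrite -(meval_dhomog_scale _ _ hom_gd); apply: meval_eq => i.
by rewrite mxE.
Qed.

(** Passing to the chart drops the components along [e]; after conjugation they lie in row 0 off the
    corner, where [lam] does not look. *)
Lemma chart_shift_wcoord (B : 'I_3 -> 'M[K]_4) : (forall i, B i \in sl K 4) ->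
  forall i j k, (i < 3)%N -> (j < 3)%N -> (k < 3)%N ->
  lam (chart_shift w Q (wcoord_mx e w B)) i j k = lam (fun l => conj_by Q (B l)) i j k.
Proof.
move=> Bsl i j k i3 j3 k3; pose b := inord j : 'I_3.
have BE : conj_by Q (B b) = \sum_l ecoord e w l (B b) *: frame0 K l +
    chart_shift w Q (wcoord_mx e w B) b.
  rewrite {1}(ewcoordE ewL (Bsl b)) conj_byD; congr (_ + conj_by Q _).
    rewrite /conj_by mulmx_sumr mulmx_suml; apply: eq_bigr => l _.
    by rewrite -scalemxAr -scalemxAl eQ -/(conj_by Q _) conj_byVK.
  by apply: eq_bigr => l _; rewrite mxvecK mxE.
rewrite /lam BE ![(_ + chart_shift _ _ _ _) _ _]mxE !summxE !big1 ?add0r //.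
- by move=> l _; rewrite !mxE (negPf (neq_lift _ _)) andbF mulr0.
by move=> l _; rewrite !mxE inordS_neq0 //= mulr0.
Qed.

Lemma cone_lift (y : 'rV[K]_('C(6, 2))) : grassmannian_cone y ->
  exists x, [/\ x *m phi = y, tangent_space Red4 x &
     forall f, tangent_cone_ideal Red4 f -> f.@[x 0] = 0].
Proof.
move=> [A [c [_ yE]]].
pose a u := c * A ord0 (inord u); pose b u : K := A ord_max (inord u).
pose W t u v := t * a u * b v - t * a v * b u.
have yW : y = wedge_row 6 (W 1).
  rewrite yE; apply/rowP => i; rewrite !mxE pluecker2E /W /a /b !inord_val !mul1r.
  by rewrite mulrBr !mulrA.
have Wskew : skew_form 6 (W 1) by move=> u v _ _; rewrite /W; ring.
(* The structure constants are linear in W and their scalar parts quadratic, so scaling a by t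
   splits the frame into orders 0, 1 and 2. *)
pose C (i : 'I_3) : 'M[K]_4 := \matrix_(r, s)
  match r : nat, s : nat with r.+1, s.+1 => struct_const (W 1) r i s | _, _ => 0 end.
pose D (i : 'I_3) : 'M[K]_4 := \matrix_(r, s)
  match r : nat, s : nat with r.+1, 0 => struct_const0 (W 1) r i | _, _ => 0 end.
have WE t (i : 'I_3) : quartic_mx (W t) i = frame0 K i + t *: C i + t ^+ 2 *: D i.
  have scE r j s : struct_const (W t) r j s = t * struct_const (W 1) r j s.
    by rewrite /struct_const /W; ring.
  have sc0E r j : struct_const0 (W t) r j = t ^+ 2 * struct_const0 (W 1) r j.
    by rewrite /struct_const0 /sum3 !scE; ring.
  apply/matrixP => -[[|r] r4] s; rewrite !mxE.
    by rewrite -!val_eqE /= !mulr0 !addr0.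
  by case: s => [[|s] s4]; rewrite /= ?scE ?sc0E ?mulr0 ?add0r ?addr0.
pose B1 i := invmx Q *m C i *m Q; pose B2 i := invmx Q *m D i *m Q.
have conj_sl X : \tr X = 0 -> invmx Q *m X *m Q \in sl K 4.
  by move=> trX; rewrite mem_sl -(trace_conj_by uQ) conj_byVK // trX.
have B1sl i : B1 i \in sl K 4.
  apply: conj_sl; rewrite -[RHS](trace_quartic_mx Wskew (ltn_ord i)).
  by apply: eq_bigr => -[[|r] r4] _; rewrite !mxE.
have B2sl i : B2 i \in sl K 4.
  by apply: conj_sl; rewrite /mxtrace big1 // => -[[|r] r4] _; rewrite !mxE.
have RB t : Red <<[tuple (tnth e i + t *: B1 i + t ^+ 2 *: B2 i)%R | i < 3]>>%VS.
  have := Red_quartic_frame (fun u => t * a u) b uQ.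
  congr (Red << val _ >>); apply: eq_from_tnth => i; rewrite !tnth_mktuple.
  rewrite [quartic_mx _ _](WE t i) eQ /B1 /B2 !mulmxDr !mulmxDl.
  by rewrite -!scalemxAr -!scalemxAl.
have [y0 [u [poly_y poly_u u0 Ry y0E]]] := chart_curve ewL B1sl B2sl RB.
exists (wcoord_mx e w B1); split.
- rewrite mul_slice_mx yW; apply: eq_wedge_row => u' v' u6 v6.
  rewrite -(omega_struct_const Wskew) //; apply: eq_omega => // i j k i3 j3 k3.
  rewrite chart_shift_wcoord // /lam /B1 !conj_byVK // !mxE !inordK //=.
  by rewrite mulr0 subr0.
- have -> : wcoord_mx e w B1 = \row_i y0 0 i by apply/rowP => i; rewrite mxE y0E.
  exact: tangent_space_curve poly_y poly_u u0 Ry.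
move=> f fT; rewrite -(meval_eq _ y0E).
exact: tangent_cone_curve poly_y poly_u u0 Ry _ fT.
Qed.

Lemma tangent_cone_grassmannian g :
  tangent_cone_ideal Red4 (pullback phi g) -> @grassmannian_ideal K 2 6 g.
Proof.
move=> Tg y /cone_lift[x [<- _ /(_ _ Tg)]].
by rewrite meval_pullback.
Qed.

Lemma slice_onto y : exists2 x, tangent_space Red4 x & x *m phi = y.
Proof.
rewrite (row_sum_delta y); elim/big_rec: _ => [|i z _ [x Tx <-]].
  by exists 0; [exact: tangent_space0 | rewrite mul0mx].
have [xi [xiE Txi _]] := cone_lift (delta_cone K i).
exists (y 0 i *: xi + x); first exact: tangent_space_linear.
by rewrite mulmxDl -scalemxAl xiE.
Qed.

(** The product of [chart_det] and [chart_omega] vanishes on the orbit, and its derivative at the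
    origin is phi. *)
Lemma O3_tangent x : tangent_space O3 x -> tangent_space Red4 x /\ x *m phi = 0.
Proof.
move=> Tx; split.
  by apply: tangent_space_sub Tx => y; apply: line_orbit_Red.
have alg := mpolyfun_subalgebra K (3 * 12); have alg1 := polyfun_subalgebra K.
apply/rowP => i; rewrite [RHS]mxE.
have [f fE] : mpolyfun (fun x => chart_det w Q x * chart_omega w Q x 0 i).
  apply: (fsubalgM alg); first exact: mpolyfun_chart_det.
  exact: mpolyfun_chart_omega.
pose h t := chart_det w Q (t *: x) * slope w Q t x 0 i.
suff : h 0 = 0 by rewrite /h chart_det0 mul1r slope0.
apply: (tangent_space_line Tx (f := f)).
- move=> z Oz; rewrite -fE; have [-> | dz] := eqVneq (chart_det w Q z) 0.
    by rewrite mul0r.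
  by rewrite (chart_omega_line uQ eQ Oz dz) mxE mulr0.
- by apply: (fsubalgM alg1); [apply: polyfun_chart_det | apply: polyfun_slope].
move=> t; have <- : f.@[(t *: x) 0] = f.@[fun i => t * x 0 i].
  by apply: meval_eq => l; rewrite mxE.
by rewrite -fE chart_omega_scale mxE mulrCA.
Qed.

End Slice.

Lemma wedge_row_eq0 (K : numFieldType) n (W : nat -> nat -> K) : skew_form n W ->
  wedge_row n W = 0 -> forall u v, (u < n)%N -> (v < n)%N -> W u v = 0.
Proof.
move=> Wskew /rowP W0.
have lt0 u v : (u < v)%N -> (v < n)%N -> W u v = 0.
  move=> uv vn; have un := ltn_trans uv vn.
  have [i iE] := @pluecker_tuple_onto 2 n [tuple Ordinal un; Ordinal vn] ltac:(by rewrite /= uv).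
  by have := W0 i; rewrite !mxE iE.
move=> u v un vn; have [uv | vu | <-] := ltngtP u v; first exact: lt0.
  by rewrite Wskew // lt0 // oppr0.
exact: skew_form_diag Wskew un.
Qed.

(** * The kernel of phi is the tangent space of the orbit *)

Section TangentKernel.
Variables (K : numClosedFieldType) (e : 3.-tuple 'M[K]_4) (w : 12.-tuple 'M[K]_4).
Variable Q : 'M[K]_4.
Hypothesis ewL : basis_of (sl K 4) (e ++ w).
Hypothesis uQ : Q \in unitmx.
Hypothesis eQ : forall i, tnth e i = invmx Q *m frame0 K i *m Q.
Implicit Types (x : 'rV[K]_(3 * 12)).

Let Red4 x := Red (chart e w x).
Let O3 x := line_orbit (chart e w x).

Lemma inord_lift (i : 'I_3) : inord i.+1 = lift ord0 i :> 'I_4.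
Proof. by apply: val_inj; rewrite /= inordK // ltnS ltn_ord. Qed.

Lemma lam_ord (B : 'I_3 -> 'M[K]_4) (i j k : 'I_3) :
  lam B i j k = B j (lift ord0 i) (lift ord0 k) - (i == k)%:R * B j ord0 ord0.
Proof. by rewrite /lam inord_val !inord_lift. Qed.

Lemma mem_span_frame0 (Z : 'M[K]_4) : Z ord0 ord0 = 0 ->
  (forall r s, Z (lift ord0 r) s = 0) -> invmx Q *m Z *m Q \in <<e>>%VS.
Proof.
move=> Z00 Z0.
have -> : Z = \sum_l Z ord0 (lift ord0 l) *: frame0 K l.
  apply/matrixP => r s; rewrite summxE; case: (unliftP ord0 r) => [r'|] ->.
    rewrite Z0 big1 // => l _; rewrite !mxE eq_sym (negPf (neq_lift _ _)).
    by rewrite /= mulr0.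
  case: (unliftP ord0 s) => [s'|] ->; last first.
    by rewrite Z00 big1 // => l _; rewrite !mxE (negPf (neq_lift _ _)) andbF mulr0.
  rewrite (bigD1 s') //= big1 => [|l ls]; first by rewrite !mxE !eqxx mulr1 addr0.
  by rewrite !mxE eqxx (inj_eq lift_inj) eq_sym (negPf ls) mulr0.
rewrite mulmx_sumr mulmx_suml; apply: memv_suml => l _.
by rewrite -scalemxAr -scalemxAl -eQ; apply/memvZ/memv_span/mem_tnth.
Qed.

Lemma frame0_mull (i : 'I_3) (A : 'M[K]_4) r s :
  (frame0 K i *m A) r s = (r == ord0)%:R * A (lift ord0 i) s.
Proof.
rewrite mxE (bigD1 (lift ord0 i)) //= big1 ?addr0 => [|l li]; rewrite !mxE ?eqxx ?andbT //.
by rewrite (negPf li) andbF mul0r.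
Qed.

Lemma frame0_mulr (i : 'I_3) (A : 'M[K]_4) r s :
  (A *m frame0 K i) r s = A r ord0 * (s == lift ord0 i)%:R.
Proof.
rewrite mxE (bigD1 ord0) //= big1 ?addr0 => [|l li]; rewrite !mxE ?eqxx //.
by rewrite (negPf li) mulr0.
Qed.

(** The first-order part at p of the commutativity of the frame; the products of the matrices in
    [frame0] vanish. *)
Lemma tangent_comm x i j : tangent_space Red4 x ->
  let B := chart_shift w Q x in
  frame0 K i *m B j + B i *m frame0 K j = frame0 K j *m B i + B j *m frame0 K i.
Proof.
move=> Tx B; have alg := mpolyfun_subalgebra K (3 * 12); have alg1 := polyfun_subalgebra K.
apply/matrixP => r s; apply/eqP; rewrite -subr_eq0; apply/eqP.
pose F y := chart_frame w Q y i *m chart_frame w Q y j.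
pose G y := chart_frame w Q y j *m chart_frame w Q y i.
have [f fE] : mpolyfun (fun y => F y r s - G y r s).
  by apply: (fsubalgB alg); apply: (fsubalg_mulmx alg) => *; apply: mpolyfun_chart_frame.
pose h t := (frame0 K i *m B j + B i *m frame0 K j) r s
  - (frame0 K j *m B i + B j *m frame0 K i) r s + t * (B i *m B j - B j *m B i) r s.
suff : h 0 = 0 by rewrite /h mul0r addr0.
apply: (tangent_space_line Tx (f := f)).
- by move=> y Ry; rewrite -fE /F /G (Red4_comm uQ eQ i j Ry) subrr.
- apply: (fsubalgD alg1); first exact: (fsubalgC alg1).
  by apply: (fsubalgM alg1); [apply: polyfun_id | apply: (fsubalgC alg1)].
move=> t; have <- : f.@[(t *: x) 0] = f.@[fun i => t * x 0 i].
  by apply: meval_eq => l; rewrite mxE.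
have mulE i' j' : chart_frame w Q (t *: x) i' *m chart_frame w Q (t *: x) j' =
    t *: (frame0 K i' *m B j' + B i' *m frame0 K j') + t ^+ 2 *: (B i' *m B j').
  rewrite !chart_frame_scale /frame_line mulmxDl !mulmxDr.
  have -> : frame0 K i' *m frame0 K j' = 0.
    by apply/matrixP => a b; rewrite frame0_mull !mxE /= mulr0.
  by rewrite add0r -!scalemxAl -!scalemxAr scalerA -expr2 scalerDr addrA.
by rewrite -fE /F /G !mulE /h !mxE; ring.
Qed.

(** Linearized commutativity makes [lam] symmetric in its lower indices. With [omega] zero it is a
    translation, and the zero trace then fixes the corner entries. *)
Lemma tangent_kernel_shape x : tangent_space Red4 x -> x *m slice_mx w Q = 0 ->
  exists a : 'I_3 -> K, forall j : 'I_3,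
  [/\ chart_shift w Q x j ord0 ord0 = - a j,
      forall r, chart_shift w Q x j (lift ord0 r) ord0 = 0
    & forall r s, chart_shift w Q x j (lift ord0 r) (lift ord0 s) = a r * (s == j)%:R].
Proof.
move=> Tx; rewrite mul_slice_mx => x0; set B := chart_shift w Q x.
have comm i j := tangent_comm i j Tx.
have lam_sym (i j k : 'I_3) : lam B i j k = lam B j i k.
  rewrite !lam_ord; have /matrixP/(_ ord0 (lift ord0 k)) := comm i j.
  rewrite [LHS]mxE [RHS]mxE !frame0_mull !frame0_mulr eqxx !mul1r !(inj_eq lift_inj).
  rewrite -/B ![k == _]eq_sym => E; apply/eqP; rewrite subr_eq addrAC -subr_eq; apply/eqP.
  by rewrite opprK [_ * B i _ _]mulrC E [_ * B j _ _]mulrC.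
have col0 (j r : 'I_3) : B j (lift ord0 r) ord0 = 0.
  (* For i distinct from j, the chosen entry of the commutation relation has the single surviving
     term B j (lift ord0 r) ord0. *)
  have [i ij] : exists i : 'I_3, i != j.
    exists (if j == ord0 then ord_max else ord0).
    by have [-> // | ] := eqVneq j ord0; rewrite eq_sym.
  have /matrixP/(_ (lift ord0 r) (lift ord0 i)) := comm i j.
  rewrite [LHS]mxE [RHS]mxE !frame0_mull !frame0_mulr eqxx !(inj_eq lift_inj) (negPf ij).
  by rewrite eq_sym (negPf (neq_lift _ _)) !mul0r mulr0 mulr1 !add0r.
have csym : const_sym (lam B).
  by move=> i j k i3 j3 k3; apply: (lam_sym (Ordinal i3) (Ordinal j3) (Ordinal k3)).
have omega0 : forall u v, (u < 6)%N -> (v < 6)%N -> omega (lam B) u v = 0.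
  by apply: wedge_row_eq0 x0 => u v u6 v6; apply: omega_skew.
pose a (i : nat) : K := 4%:R^-1 * sum3 (fun l => lam B i l l).
have lamE (i j k : 'I_3) : lam B i j k = translation a i j k.
  rewrite (struct_const_omega csym) // [X in X + _](_ : _ = 0) ?add0r //.
  have idx : forall p q, (p < 3)%N -> (q < 3)%N -> (conic_index p q < 6)%N.
    by move=> [|[|[|//]]] [|[|[|//]]].
  have nx p : (next3 p < 3)%N by case: p => [|[|[|p]]].
  by rewrite /struct_const !omega0 ?idx ?nx // subr0.
have B00 (j : 'I_3) : B j ord0 ord0 = - a j.
  have trB : \tr (B j) = 0.
    rewrite /B /chart_shift trace_conj_by // raddf_sum big1 // => l _.
    by rewrite /= mxtraceZ (eqP (_ : \tr (tnth w l) == 0)) ?mulr0 // -mem_sl (w_in_L ewL).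
  have sum_lam : \sum_(i < 3) lam B i j i = 4%:R * a j.
    rewrite (eq_bigr (fun i : 'I_3 => a i * (j == i)%:R + a j)); last first.
      by move=> i _; rewrite lamE /translation eqxx mulr1.
    rewrite big_split /= sumr_const card_ord (bigD1 j) //= eqxx mulr1 big1 => [|i ij].
      by rewrite addr0; ring.
    by rewrite eq_sym (negPf ij) mulr0.
  have : \sum_(i < 3) lam B i j i = \tr (B j) - 4%:R * B j ord0 ord0.
    rewrite [LHS](eq_bigr (fun i : 'I_3 =>
      B j (lift ord0 i) (lift ord0 i) - B j ord0 ord0)); last first.
      by move=> i _; rewrite lam_ord eqxx mul1r.
    by rewrite sumrB sumr_const card_ord /mxtrace [in RHS]big_ord_recl; ring.
  rewrite sum_lam trB sub0r -mulrN => /(mulfI _)->; rewrite ?opprK //.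
  by rewrite Num.Theory.pnatr_eq0.
exists (fun i => a i) => j; split=> // r s.
have := lamE r j s; rewrite lam_ord B00 /translation => /eqP.
rewrite subr_eq => /eqP ->; rewrite -!val_eqE /= [val j == _]eq_sym; ring.
Qed.

Lemma tangent_kernel x : tangent_space Red4 x -> x *m slice_mx w Q = 0 ->
  tangent_space O3 x.
Proof.
move=> Tx /(tangent_kernel_shape Tx)[a aP].
(* The line spanned by (1, t a) moves in the direction a; the rows of [R] are a basis of the linear
   forms that vanish on it. *)
pose v t : 'cV[K]_4 := \col_r (if unlift ord0 r is Some r' then t * a r' else 1).
pose R t : 'M[K]_(3, 4) := \matrix_(j, s)
  if unlift ord0 s is Some s' then (s' == j)%:R else - (t * a j).
pose C (j : 'I_3) : 'M[K]_4 := \matrix_(r, s)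
  match unlift ord0 r, unlift ord0 s with
  | Some r', Some s' => a r' * (s' == j)%:R
  | None, None => - a j
  | _, _ => 0
  end.
pose D (j : 'I_3) : 'M[K]_4 := \matrix_(r, s)
  match unlift ord0 r, unlift ord0 s with Some r', None => - (a r' * a j) | _, _ => 0 end.
have vR t j : v t *m row j (R t) = frame0 K j + t *: C j + t ^+ 2 *: D j.
  apply/matrixP => r s; rewrite !mxE big_ord1 !mxE.
  case: (unliftP ord0 r) => [r'|] ->; case: (unliftP ord0 s) => [s'|] ->;
    rewrite ?unlift_none ?liftK ?eqxx ?[lift _ _ == ord0]eq_sym
      ?(inj_eq lift_inj) ?(negPf (neq_lift _ _)) /=; ring.
have v0 t : invmx Q *m v t != 0.
  apply/negP => /eqP /(congr1 (mulmx Q)); rewrite mulmx0 mulKVmx // => /matrixP/(_ ord0 0).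
  by rewrite !mxE unlift_none => /eqP; rewrite oner_eq0.
have Rfree t : row_free (R t *m Q).
  apply/row_freeP; exists (invmx Q *m \matrix_(s, j) (s == lift ord0 j)%:R).
  rewrite mulmxA mulmxK //; apply/matrixP => i j; rewrite !mxE.
  rewrite (bigD1 (lift ord0 j)) //= !mxE liftK eqxx mulr1 big1 ?addr0 1?eq_sym //.
  by move=> s sj; rewrite !mxE (negPf sj) mulr0.
have Rv t : R t *m Q *m (invmx Q *m v t) = 0.
  rewrite mulmxA mulmxK //; apply/matrixP => j z; rewrite ord1 !mxE big_ord_recl.
  rewrite !mxE unlift_none mulr1 (bigD1 j) //= !mxE liftK eqxx mul1r addrA addNr add0r.
  by apply: big1 => i ij; rewrite !mxE liftK (negPf ij) mul0r.
pose B1 i := invmx Q *m C i *m Q; pose B2 i := invmx Q *m D i *m Q.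
have conj_sl X : \tr X = 0 -> invmx Q *m X *m Q \in sl K 4.
  by move=> trX; rewrite mem_sl -(trace_conj_by uQ) conj_byVK // trX.
have B1sl i : B1 i \in sl K 4.
  apply: conj_sl; rewrite /mxtrace big_ord_recl (bigD1 i) //= !mxE unlift_none liftK eqxx mulr1.
  by rewrite addKr big1 // => j /negPf ji; rewrite !mxE liftK ji mulr0.
have B2sl i : B2 i \in sl K 4.
  by apply: conj_sl; apply: big1 => r _; rewrite mxE; case: unlift.
have OB t : line_orbit <<[tuple (tnth e i + t *: B1 i + t ^+ 2 *: B2 i)%R | i < 3]>>%VS.
  have := line_orbit_line_frame (v0 t) (Rfree t) (Rv t).
  congr (line_orbit << val _ >>); apply: eq_from_tnth => i; rewrite !tnth_mktuple.
  rewrite row_mul mulmxA -[invmx Q *m v t *m _]mulmxA vR eQ /B1 /B2 !mulmxDr !mulmxDl.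
  by rewrite -!scalemxAr -!scalemxAl.
have [y [u [poly_y poly_u u0 Oy y0]]] := chart_curve ewL B1sl B2sl OB.
(* By the shape found for the kernel, [C] and the shift of x differ only in row 0 off the corner,
   that is, by elements of p. *)
have <- : wcoord_mx e w B1 = x.
  apply: (wcoord_mxE ewL) => i; have [B00 Br0 Brs] := aP i.
  exists (invmx Q *m (C i - chart_shift w Q x i) *m Q).
    apply: mem_span_frame0 => [|r s].
      by rewrite mxE [X in _ + X]mxE B00 mxE unlift_none subrr.
    rewrite mxE [X in _ + X]mxE mxE liftK; case: (unliftP ord0 s) => [s'|] ->.
      by rewrite Brs subrr.
    by rewrite Br0 subrr.
  by rewrite mulmxBr mulmxBl conj_byK // addrNK.
have -> : wcoord_mx e w B1 = \row_i y 0 i by apply/rowP => i; rewrite mxE y0.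
exact: tangent_space_curve poly_y poly_u u0 Oy.
Qed.

End TangentKernel.

Theorem proposition23 (R : realType) (p : {vspace 'M[R[i]]_4})
    (e : 3.-tuple 'M[R[i]]_4) (w : 12.-tuple 'M[R[i]]_4) :
  line_orbit p -> basis_of p e -> basis_of (sl R[i] 4) (e ++ w) ->
  let Red4 := fun x : 'rV[R[i]]_(3 * 12) => Red (chart e w x) in
  let O3 := fun x : 'rV[R[i]]_(3 * 12) => line_orbit (chart e w x) in
  exists phi : 'M[R[i]]_(3 * 12, 15),
    quotient_iso (tangent_space Red4) (tangent_space O3) phi
    /\ same_Proj (image_ideal phi (tangent_cone_ideal Red4))
                 (@grassmannian_ideal R[i] 2 6).
Proof.
move=> lp ep ewL Red4 O3.
have [Q uQ eQ] := line_orbit_frame lp ep.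
exists (slice_mx w Q); split; [split|].
- move=> x; split=> [Tx | [Tx x0]]; first exact: (O3_tangent uQ eQ Tx).
  exact: (tangent_kernel ewL uQ eQ Tx x0).
- exact: (slice_onto ewL uQ eQ).
(* The two ideals coincide, so their saturations do. *)
have eq_ideal g : image_ideal (slice_mx w Q) (tangent_cone_ideal Red4) g <->
    @grassmannian_ideal R[i] 2 6 g.
  split; first exact: (tangent_cone_grassmannian ewL uQ eQ).
  exact: (grassmannian_tangent_cone w uQ eQ).
by move=> f; split=> -[d fd]; exists d => m /fd /eq_ideal.
Qed.
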